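(* Let $\beta,\beta_1$ be real numbers with $\beta<\beta_1\le1$. Then $M_{0,\beta}\subseteq M_{0,\beta_1}$.
   Context: $\mathbb{D}$ is the open unit disk in $\mathbb{C}$. $\mathcal{A}$ is the set of holomorphic functions $f:\mathbb{D}\to\mathbb{C}$ with $f(0)=0$, $f'(0)=1$. For real $\beta$, $$M_{0,\beta}=\left\{f\in\mathcal{A}:\ \operatorname{Re}\left[\beta\frac{zf'(z)}{f(z)}+(1-\beta)\left(1+\frac{zf''(z)}{f'(z)}\right)\right]>\frac{\beta}{2}\ \text{ for all } z\in\mathbb{D}\right\},$$ where $zf'(z)/f(z)$ has value $1$ at $z=0$, a term with zero coefficient is omitted, and the expression is required to be well defined on $\mathbb{D}$: $f(z)\ne0$ for $z\in\mathbb{D}\setminus\{0\}$ if $\beta\neq0$, and $f'(z)\ne0$ on $\mathbb{D}$ if $\beta\ne1$. *)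

(* Defs.v *)
From Stdlib Require Import Reals.
From Coquelicot Require Import Coquelicot.

Local Open Scope R_scope.

(** A function on the unit disk is represented by a total function [C -> C];
    every predicate below depends only on its values on the disk, since
    complex derivatives at points of an open set are local. *)

Definition unit_disk (z : C) : Prop := Cmod z < 1.

(** The base field [C_AbsRing] is given explicitly so that [ex_derive] is
    complex, not real, differentiability. *)
Definition holomorphic_on (U : C -> Prop) (f : C -> C) : Prop :=
  forall z : C, U z -> @ex_derive C_AbsRing C_NormedModule f z.

Definition classA (f : C -> C) : Prop :=
  holomorphic_on unit_disk f /\ f (RtoC 0) = RtoC 0 /\
  C_derive f (RtoC 0) = RtoC 1.

(** [z f'(z) / f(z)], with the value [1] at the removable singularity [0]. *)
Definition starlike_quot (f : C -> C) (z : C) : C :=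
  if Ceq_dec z (RtoC 0) then RtoC 1 else (z * C_derive f z / f z)%C.

Definition convex_quot (f : C -> C) (z : C) : C :=
  (1 + z * C_derive (C_derive f) z / C_derive f z)%C.

(** Division in [C] is total and [0 * c = 0], so in [M0_expr] a term with zero
    coefficient vanishes even where its quotient has a zero denominator. *)
Definition M0_expr (beta : R) (f : C -> C) (z : C) : C :=
  (RtoC beta * starlike_quot f z + RtoC (1 - beta) * convex_quot f z)%C.

Definition M0_well_defined (beta : R) (f : C -> C) : Prop :=
  (beta <> 0 -> forall z : C, unit_disk z -> z <> RtoC 0 -> f z <> RtoC 0) /\
  (beta <> 1 -> forall z : C, unit_disk z -> C_derive f z <> RtoC 0).

Definition M0 (beta : R) (f : C -> C) : Prop :=
  classA f /\ M0_well_defined beta f /\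
  forall z : C, unit_disk z -> Re (M0_expr beta f z) > beta / 2.

(* Main.v *)
Require Import Defs.
From Stdlib Require Import Reals Lra Lia List ClassicalEpsilon.
From Coquelicot Require Import Coquelicot.

(** Write [p = z f' / f]. Then [1 + z f'' / f' = p + z p' / p], so with
    [alpha = 1 - beta > 0] the hypothesis reads [Re (p + alpha z p' / p) > (1 - alpha) / 2].
    The point is that it forces [Re p > 1/2]. Granting this, for [beta < beta1 <= 1] the
    expression with parameter [beta1] is the convex combination of the one with parameter
    [beta] and of [p] with weights [(1 - beta1) / (1 - beta)] and the complement, and the
    same combination of the two lower bounds is exactly [beta1 / 2].

    To get [Re p > 1/2], put [h = 1 / p = f / (z f')] and [w = 1 - h]; [h] is holomorphic
    because [f'] has no zero, [w(0) = 0], and [Re p > 1/2] means [|w| < 1]. If [|w|] reached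
    [1] in the disk, Jack's lemma ([jack]) would give a point with [|w| = 1] and
    [z w' = k w], [k >= 1] real. Unless [w = 1] there, [p + alpha z p' / p] equals
    [(1 + alpha k w) / (1 - w)], whose real part is [(1 - alpha k) / 2 <= (1 - alpha) / 2]:
    a contradiction. If [w = 1] there, then [h = 0], and differentiating [f = z f' h] gives
    [z h' = 1], that is [k = -1], again absurd; this also shows that [f] has no zero other
    than [0] when [beta = 0], where nonvanishing is not part of the hypothesis.

    Jack's lemma is Schwarz's lemma on the closed disk through the first point where
    [|w| = 1], read infinitesimally at that point.

    Most of the development is the complex analysis behind this, starting from
    differentiability at each point only, since [f''] has to be shown to exist. Goursat's
    theorem for triangles ([goursat]) provides a primitive [F] of [f], and [F] has a
    continuous derivative, so Cauchy's formula for [F] follows by contracting the circle to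
    a point and differentiating under the integral sign ([cauchy_formula_C1]). Differentiating
    the formula shows that [f = F'] is twice differentiable ([holomorphic_C_derive]); the
    formula then holds for [f] itself, and gives the removable singularity of [f(z)/z]
    ([removable_quotient]) and the maximum modulus principle ([maximum_modulus]). *)

Local Open Scope R_scope.

Local Notation Ccontinuous := (@continuous C_UniformSpace C_UniformSpace).
Local Notation Rcontinuous := (@continuous R_UniformSpace C_UniformSpace).
Local Notation is_Cderive f z l := (@is_derive C_AbsRing C_NormedModule f (z : C)%C (l : C)%C).
Local Notation cont := (@continuous _ C_UniformSpace).
Local Notation is_CRInt f a b l := (@is_RInt C_R_NormedModule f a b (l : C)%C).
Local Notation CRInt f a b := (@RInt C_R_CompleteNormedModule f a b : C).
Local Notation is_RCderive f t l := (@is_derive R_AbsRing C_R_NormedModule f t (l : C)%C).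

(** * Neighbourhoods, continuity and derivatives in terms of the modulus *)

(** The plane carries several uniform structures: the product one, the one of its absolute
    value, and those of its two normed-module structures over the reals and over itself.
    The characterizations by [Cmod] are common to all of them. *)
Lemma locally_Cmod (z : C) (P : C -> Prop) :
  @locally C_UniformSpace z P <->
  exists d, 0 < d /\ forall y, Cmod (y - z) < d -> P y.
Proof.
  split.
  - intros H; apply locally_C in H. destruct H as [d Hd].
    exists d; split; [apply cond_pos|]. intros y Hy; apply Hd. exact Hy.
  - intros (d & Hd & H). apply locally_C. exists (mkposreal d Hd).
    intros y Hy; apply H; exact Hy.
Qed.

Lemma continuous_Cmod (U : UniformSpace) (g : U -> C) (x : U) :
  @continuous U C_UniformSpace g x <->
  forall e, 0 < e -> locally x (fun y => Cmod (g y - g x) < e).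
Proof.
  split.
  - intros H e He. apply (H (fun w : C => Cmod (w - g x) < e)).
    apply locally_Cmod. exists e; split; auto.
  - intros H P HP. apply locally_Cmod in HP. destruct HP as (d & Hd & HP).
    generalize (H d Hd). apply (filter_imp (F := locally x)). intros y Hy; apply HP, Hy.
Qed.

Lemma is_Cderive_Cmod (f : C -> C) (z l : C) :
  is_Cderive f z l <->
  forall e, 0 < e -> @locally C_UniformSpace z
    (fun y => Cmod (f y - f z - l * (y - z)) <= e * Cmod (y - z)).
Proof.
  split.
  - intros [_ H] e He. apply locally_C.
    generalize (H z (fun P HP => HP) (mkposreal e He)). apply filter_imp.
    intros y Hy. cbn in Hy. rewrite Cmult_comm. exact Hy.
  - intros H. split.
    + apply is_linear_scal_l.
    + intros x Hx. replace x with z.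
      2:{ apply (is_filter_lim_locally_unique (V:=AbsRing_NormedModule C_AbsRing) z x Hx). }
      intros e. apply locally_C. generalize (H e (cond_pos e)). apply filter_imp.
      intros y Hy. cbn. rewrite Cmult_comm in Hy. exact Hy.
Qed.

Lemma is_RCderive_Cmod (g : R -> C) (t : R) (l : C) :
  is_RCderive g t l <->
  forall e, 0 < e -> locally t
    (fun s => Cmod (g s - g t - l * (s - t)) <= e * Rabs (s - t)).
Proof.
  assert (E : forall s : R, @minus C_R_NormedModule (minus (g s) (g t)) (scal (minus s t) l) =
     (g s - g t - l * (s - t))%C).
  { intros s. change (minus s t) with (s - t). rewrite scal_R_Cmult.
    rewrite RtoC_minus, Cmult_comm. reflexivity. }
  assert (N : forall u : C, @norm R_AbsRing C_R_NormedModule u = Cmod u).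
  { intros u. symmetry. exact (Cmod_norm u). }
  split.
  - intros [_ H] e He.
    generalize (H t (fun P HP => HP) (mkposreal e He)). apply filter_imp.
    intros y Hy. rewrite <- E, <- N. exact Hy.
  - intros H. split.
    + apply is_linear_scal_l.
    + intros x Hx. replace x with t.
      2:{ apply (is_filter_lim_locally_unique (V:=R_NormedModule) t x Hx). }
      intros e. generalize (H e (cond_pos e)). apply filter_imp.
      intros y Hy. rewrite <- E, <- N in Hy. exact Hy.
Qed.

(** * Rules for continuity and differentiation *)

Lemma Cmod_minus_sym (a b : C) : Cmod (a - b) = Cmod (b - a).
Proof. rewrite <- Cmod_opp. f_equal. ring. Qed.

Lemma Cmod_triangle_minus (a b : C) : Cmod a - Cmod b <= Cmod (a - b).
Proof.
  generalize (Cmod_triangle (a - b) b).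
  replace (a - b + b)%C with a by ring. lra.
Qed.

Lemma cont_const {U : UniformSpace} (c : C) (x : U) : cont (fun _ => c) x.
Proof. apply continuous_const. Qed.

Lemma cont_ext_loc {U : UniformSpace} (f g : U -> C) x :
  locally x (fun y => f y = g y) -> cont f x -> cont g x.
Proof. intros H. apply continuous_ext_loc. generalize H; apply filter_imp; auto. Qed.

Lemma cont_plus {U : UniformSpace} (f g : U -> C) x :
  cont f x -> cont g x -> cont (fun y => f y + g y)%C x.
Proof. exact (@continuous_plus U R_AbsRing C_R_NormedModule f g x). Qed.

Lemma cont_minus {U : UniformSpace} (f g : U -> C) x :
  cont f x -> cont g x -> cont (fun y => f y - g y)%C x.
Proof. exact (@continuous_minus U R_AbsRing C_R_NormedModule f g x). Qed.

Lemma cont_mult {U : UniformSpace} (f g : U -> C) x :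
  cont f x -> cont g x -> cont (fun y => f y * g y)%C x.
Proof.
  intros Hf Hg. apply continuous_Cmod. intros e He.
  pose proof (Cmod_ge_0 (f x)) as Pf. pose proof (Cmod_ge_0 (g x)) as Pg.
  set (K := Cmod (f x) + Cmod (g x) + 2).
  assert (HK : 0 < K) by (unfold K; lra).
  assert (H1 : 0 < Rmin 1 (e / K)).
  { apply Rmin_glb_lt; [lra|]. apply Rdiv_lt_0_compat; lra. }
  apply continuous_Cmod with (e := Rmin 1 (e / K)) in Hf; [|exact H1].
  apply continuous_Cmod with (e := Rmin 1 (e / K)) in Hg; [|exact H1].
  generalize (filter_and _ _ Hf Hg). apply filter_imp. intros y [A B].
  pose proof (Rmin_l 1 (e / K)). pose proof (Rmin_r 1 (e / K)).
  replace (f y * g y - f x * g x)%C with ((f y - f x) * g y + f x * (g y - g x))%C by ring.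
  eapply Rle_lt_trans; [apply Cmod_triangle|]. rewrite !Cmod_mult.
  pose proof (Cmod_triangle_minus (g y) (g x)).
  pose proof (Cmod_ge_0 (f y - f x)). pose proof (Cmod_ge_0 (g y - g x)).
  pose proof (Cmod_ge_0 (g y)).
  assert (E : e / K * K = e) by (field; lra).
  set (q := e / K) in *.
  assert (0 < q) by (apply Rdiv_lt_0_compat; lra).
  apply Rle_lt_trans with (q * (Cmod (g x) + 1) + Cmod (f x) * q).
  - apply Rplus_le_compat; [apply Rmult_le_compat|apply Rmult_le_compat]; lra.
  - rewrite <- E. unfold K. nra.
Qed.

Lemma cont_inv {U : UniformSpace} (f : U -> C) x :
  f x <> 0 -> cont f x -> cont (fun y => / f y)%C x.
Proof.
  intros Hx Hf. apply continuous_Cmod. intros e He.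
  apply Cmod_gt_0 in Hx as Px.
  set (m := Cmod (f x)) in *.
  assert (Hq : 0 < e * m * m / 2).
  { apply Rdiv_lt_0_compat; [|lra]. repeat apply Rmult_lt_0_compat; lra. }
  assert (H1 : 0 < Rmin (m / 2) (e * m * m / 2)) by (apply Rmin_glb_lt; lra).
  apply continuous_Cmod with (1 := Hf) in H1.
  generalize H1. apply filter_imp. intros y A.
  pose proof (Rmin_l (m / 2) (e * m * m / 2)). pose proof (Rmin_r (m / 2) (e * m * m / 2)).
  rewrite Cmod_minus_sym in A.
  pose proof (Cmod_triangle_minus (f x) (f y)) as B. fold m in B.
  assert (Hy : f y <> 0). { apply Cmod_gt_0. lra. }
  replace (/ f y - / f x)%C with ((f x - f y) / (f x * f y))%C by (field; auto).
  rewrite Cmod_div, Cmod_mult by (apply Cmult_neq_0; auto). fold m.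
  assert (Hm : 0 < m * Cmod (f y)) by (apply Rmult_lt_0_compat; lra).
  apply Rmult_lt_reg_r with (1 := Hm).
  unfold Rdiv. rewrite Rmult_assoc, Rinv_l, Rmult_1_r by lra.
  eapply Rlt_le_trans; [apply A|].
  apply Rle_trans with (e * m * m / 2); [lra|].
  replace (e * (m * Cmod (f y))) with (e * m * Cmod (f y)) by ring.
  replace (e * m * m / 2) with (e * m * (m / 2)) by field.
  apply Rmult_le_compat_l; [|lra]. apply Rmult_le_pos; lra.
Qed.

(** Caratheodory's form of differentiability turns every rule of differentiation into a
    statement about continuity of the slope [q]. *)
Lemma Caratheodory (f : C -> C) (z l : C) :
  is_Cderive f z l ->
  exists q, Ccontinuous q z /\ q z = l /\ forall y, f y = (f z + q y * (y - z))%C.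
Proof.
  intros H.
  exists (fun y => if Ceq_dec y z then l else ((f y - f z) / (y - z))%C).
  assert (Hz : (if Ceq_dec z z then l else ((f z - f z) / (z - z))%C) = l).
  { destruct (Ceq_dec z z); [reflexivity|easy]. }
  split; [|split; [exact Hz|]].
  - apply continuous_Cmod. intros e He. rewrite Hz.
    assert (He2 : 0 < e / 2) by lra.
    pose proof (proj1 (is_Cderive_Cmod _ _ _) H _ He2) as H'.
    generalize H'. apply filter_imp. intros y Hy.
    destruct (Ceq_dec y z) as [->|n].
    + replace (l - l)%C with (RtoC 0) by ring. rewrite Cmod_0. exact He.
    + apply Cminus_eq_contra in n. apply Cmod_gt_0 in n as P.
      replace ((f y - f z) / (y - z) - l)%C
        with ((f y - f z - l * (y - z)) / (y - z))%C by (field; auto).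
      rewrite Cmod_div by auto. apply Rle_lt_trans with (e / 2); [|lra].
      apply Rmult_le_reg_r with (1 := P). unfold Rdiv at 1.
      rewrite Rmult_assoc, Rinv_l, Rmult_1_r by lra. exact Hy.
  - intros y. destruct (Ceq_dec y z) as [->|n]; [ring|].
    apply Cminus_eq_contra in n. field; auto.
Qed.

Lemma Caratheodory_loc (f q : C -> C) (z : C) :
  Ccontinuous q z -> @locally C_UniformSpace z (fun y => f y = (f z + q y * (y - z))%C) ->
  is_Cderive f z (q z).
Proof.
  intros Hq Hf. apply is_Cderive_Cmod. intros e He.
  apply continuous_Cmod with (e := e) in Hq; [|exact He].
  generalize (filter_and _ _ Hf Hq). apply filter_imp. intros y [-> B].
  replace (f z + q y * (y - z) - f z - q z * (y - z))%C
    with ((q y - q z) * (y - z))%C by ring.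
  rewrite Cmod_mult. apply Rmult_le_compat_r; [apply Cmod_ge_0|lra].
Qed.

Lemma Caratheodory_all (f q : C -> C) (z : C) :
  Ccontinuous q z -> (forall y, f y = (f z + q y * (y - z))%C) ->
  is_Cderive f z (q z).
Proof.
  intros Hq Hf. apply Caratheodory_loc; [exact Hq|]. apply filter_forall, Hf.
Qed.

Lemma is_Cderive_continuous (f : C -> C) (z l : C) :
  is_Cderive f z l -> Ccontinuous f z.
Proof.
  intros H. destruct (Caratheodory _ _ _ H) as (q & Hq & _ & Hf).
  apply (cont_ext_loc (fun y => f z + q y * (y - z))%C).
  - apply filter_forall. intros y; symmetry; apply Hf.
  - apply cont_plus; [apply cont_const|]. apply cont_mult; [exact Hq|].
    apply cont_minus; [apply continuous_id|apply cont_const].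
Qed.

Lemma is_Cderive_unique (f : C -> C) (z l1 l2 : C) :
  is_Cderive f z l1 -> is_Cderive f z l2 -> l1 = l2.
Proof.
  intros H1 H2. apply is_C_derive_unique in H1, H2. congruence.
Qed.

Lemma is_Cderive_ext_loc (f g : C -> C) (z l : C) :
  @locally C_UniformSpace z (fun y => f y = g y) -> is_Cderive f z l -> is_Cderive g z l.
Proof.
  intros H Hf. apply is_Cderive_Cmod. intros e He.
  pose proof (proj1 (is_Cderive_Cmod _ _ _) Hf e He) as H'.
  pose proof (locally_singleton _ _ H) as Hz.
  generalize (filter_and _ _ H H'). apply filter_imp. intros y [<- B].
  rewrite <- Hz. exact B.
Qed.

Lemma is_Cderive_const (c z : C) : is_Cderive (fun _ => c) z 0.
Proof.
  apply (Caratheodory_all _ (fun _ => RtoC 0)); [apply cont_const|].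
  intros y; ring.
Qed.

Lemma is_Cderive_id (z : C) : is_Cderive (fun y => y) z 1.
Proof.
  apply (Caratheodory_all _ (fun _ => RtoC 1)); [apply cont_const|].
  intros y; ring.
Qed.

Lemma is_Cderive_mult (f g : C -> C) (z a b : C) :
  is_Cderive f z a -> is_Cderive g z b ->
  is_Cderive (fun y => f y * g y)%C z (a * g z + f z * b).
Proof.
  intros Hf Hg.
  pose proof (is_Cderive_continuous _ _ _ Hg) as Cg.
  destruct (Caratheodory _ _ _ Hf) as (p & Hp & <- & Ef).
  destruct (Caratheodory _ _ _ Hg) as (q & Hq & <- & Eg).
  apply (Caratheodory_all _ (fun y => p y * g y + f z * q y)%C).
  - apply cont_plus; apply cont_mult; auto. apply cont_const.
  - intros y; rewrite (Ef y), (Eg y); ring.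
Qed.

Lemma is_Cderive_minus (f g : C -> C) (z a b : C) :
  is_Cderive f z a -> is_Cderive g z b -> is_Cderive (fun y => f y - g y)%C z (a - b).
Proof.
  intros Hf Hg.
  destruct (Caratheodory _ _ _ Hf) as (p & Hp & <- & Ef).
  destruct (Caratheodory _ _ _ Hg) as (q & Hq & <- & Eg).
  apply (Caratheodory_all _ (fun y => p y - q y)%C); [now apply cont_minus|].
  intros y; rewrite (Ef y), (Eg y); ring.
Qed.

Lemma is_Cderive_inv (f : C -> C) (z a : C) :
  f z <> 0 -> is_Cderive f z a ->
  is_Cderive (fun y => / f y)%C z (- a / (f z * f z)).
Proof.
  intros Hz Hf.
  pose proof (is_Cderive_continuous _ _ _ Hf) as Cf.
  destruct (Caratheodory _ _ _ Hf) as (p & Hp & <- & Ef).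
  replace (- p z / (f z * f z))%C with (- (1) * p z * (/ f z * / f z))%C by (field; auto).
  apply (Caratheodory_loc _ (fun y => - (1) * p y * (/ f z * / f y))%C).
  - apply cont_mult; apply cont_mult; auto; try apply cont_const. now apply cont_inv.
  - apply Cmod_gt_0 in Hz as P.
    generalize (proj1 (continuous_Cmod _ _ _) Cf _ P). apply filter_imp.
    intros y Hy. rewrite Cmod_minus_sym in Hy.
    pose proof (Cmod_triangle_minus (f z) (f y)).
    assert (Hy0 : f y <> 0) by (apply Cmod_gt_0; lra).
    assert (E : (p y * (y - z) = f y - f z)%C) by (rewrite (Ef y); ring).
    replace (- (1) * p y * (/ f z * / f y) * (y - z))%C
      with (- (1) * (p y * (y - z)) * (/ f z * / f y))%C by ring.
    rewrite E. field; auto.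
Qed.

Lemma is_RCderive_continuous (p : R -> C) (t : R) (l : C) :
  is_RCderive p t l -> Rcontinuous p t.
Proof.
  intros H. apply (@ex_derive_continuous R_AbsRing C_R_NormedModule). now exists l.
Qed.

(** The two derivatives are taken over different fields, so this is not an instance of the
    chain rule for maps between normed modules over one field. *)
Lemma is_RCderive_comp (g : C -> C) (p : R -> C) (t : R) (a b : C) :
  is_Cderive g (p t) a -> is_RCderive p t b -> is_RCderive (fun s => g (p s)) t (a * b).
Proof.
  intros Hg Hp.
  assert (Cp : Rcontinuous p t) by exact (is_RCderive_continuous _ _ _ Hp).
  destruct (Caratheodory _ _ _ Hg) as (q & Hq & <- & Eg).
  apply is_RCderive_Cmod. intros e He.
  pose proof (Cmod_ge_0 b). pose proof (Cmod_ge_0 (q (p t))).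
  set (e1 := e / (2 * (Cmod b + 1))).
  assert (H1 : 0 < e1) by (apply Rdiv_lt_0_compat; lra).
  pose proof (continuous_comp p q t Cp Hq) as Hc.
  pose proof (proj1 (continuous_Cmod _ _ _) Hc e1 H1) as L1.
  set (K := Cmod (q (p t)) + e1 + 1).
  assert (HK : 0 < K) by (unfold K; lra).
  assert (H2 : 0 < e / (2 * K)) by (apply Rdiv_lt_0_compat; lra).
  pose proof (proj1 (is_RCderive_Cmod _ _ _) Hp _ H2) as L2.
  generalize (filter_and _ _ L1 L2). apply filter_imp. intros s [A B].
  rewrite (Eg (p s)).
  replace (g (p t) + q (p s) * (p s - p t) - g (p t) - q (p t) * b * (s - t))%C
    with (q (p s) * (p s - p t - b * (s - t)) + (q (p s) - q (p t)) * b * (s - t))%C by ring.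
  eapply Rle_trans; [apply Cmod_triangle|]. rewrite !Cmod_mult.
  rewrite <- RtoC_minus, Cmod_R.
  pose proof (Rabs_pos (s - t)) as Ps.
  pose proof (Cmod_triangle_minus (q (p s)) (q (p t))) as T.
  rewrite <- RtoC_minus in B.
  replace e with (K * (e / (2 * K)) + e1 * (Cmod b + 1)).
  2:{ unfold e1. field. split; lra. }
  rewrite Rmult_plus_distr_r. apply Rplus_le_compat.
  - rewrite Rmult_assoc. apply Rmult_le_compat; try apply Cmod_ge_0; try (unfold K; lra).
    eapply Rle_trans; [apply B|]. apply Rmult_le_compat_r; lra.
  - apply Rmult_le_compat_r; [lra|]. apply Rmult_le_compat; try apply Cmod_ge_0; lra.
Qed.

Lemma is_RCderive_affine (a b : C) (t : R) : is_RCderive (fun s => a + s * b)%C t b.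
Proof.
  apply is_RCderive_Cmod. intros e He. apply filter_forall. intros s.
  replace (a + s * b - (a + t * b) - b * (s - t))%C with (RtoC 0) by ring.
  rewrite Cmod_0. apply Rmult_le_pos; [lra|apply Rabs_pos].
Qed.

Lemma Cmod_le_abs (z : C) : Cmod z <= Rabs (Re z) + Rabs (Im z).
Proof.
  assert (E : z = (Re z + Ci * Im z)%C).
  { destruct z as [x y]. apply injective_projections; cbn; ring. }
  rewrite E at 1. eapply Rle_trans; [apply Cmod_triangle|].
  rewrite Cmod_mult, !Cmod_R, Cmod_Ci. lra.
Qed.

Lemma is_RCderive_pair (u v : R -> R) (t a b : R) :
  is_derive u t a -> is_derive v t b ->
  is_RCderive (fun s => (u s, v s)) t (a, b).
Proof.
  intros [_ Hu] [_ Hv]. apply is_RCderive_Cmod. intros e He.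
  assert (He2 : 0 < e / 2) by lra.
  generalize (filter_and _ _ (Hu t (fun P HP => HP) (mkposreal _ He2))
    (Hv t (fun P HP => HP) (mkposreal _ He2))). apply filter_imp. intros s [A B].
  change (Rabs (u s - u t - (s - t) * a) <= e / 2 * Rabs (s - t)) in A.
  change (Rabs (v s - v t - (s - t) * b) <= e / 2 * Rabs (s - t)) in B.
  eapply Rle_trans; [apply Cmod_le_abs|].
  replace (Re ((u s, v s) - (u t, v t) - (a, b) * (s - t))%C) with (u s - u t - (s - t) * a)
    by (cbn; ring).
  replace (Im ((u s, v s) - (u t, v t) - (a, b) * (s - t))%C) with (v s - v t - (s - t) * b)
    by (cbn; ring).
  lra.
Qed.

(** * Integrals of complex-valued functions *)

Lemma is_CRInt_unique (g : R -> C) (a b : R) (I J : C) :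
  is_CRInt g a b I -> is_CRInt g a b J -> I = J.
Proof.
  intros H1 H2.
  rewrite <- (@is_RInt_unique C_R_CompleteNormedModule g a b I H1).
  exact (@is_RInt_unique C_R_CompleteNormedModule g a b J H2).
Qed.

Lemma CRInt_correct (g : R -> C) (a b : R) : a <= b ->
  (forall t, a <= t <= b -> Rcontinuous g t) ->
  is_CRInt g a b (CRInt g a b).
Proof.
  intros Hab H. apply (@RInt_correct C_R_CompleteNormedModule).
  apply (@ex_RInt_continuous C_R_CompleteNormedModule).
  rewrite Rmin_left, Rmax_right by exact Hab. exact H.
Qed.

Lemma is_CRInt_minus (f g : R -> C) (a b : R) (I J : C) :
  is_CRInt f a b I -> is_CRInt g a b J -> is_CRInt (fun t => f t - g t)%C a b (I - J).
Proof. exact (@is_RInt_minus C_R_NormedModule f g a b I J). Qed.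

(** Complex scalars are not part of the real module structure, hence the passage through
    real and imaginary parts. *)
Lemma is_CRInt_mult (c : C) (f : R -> C) (a b : R) (I : C) :
  is_CRInt f a b I -> is_CRInt (fun t => c * f t)%C a b (c * I).
Proof.
  intros H.
  pose proof (@is_RInt_fct_extend_fst R_NormedModule R_NormedModule f a b I H) as H1.
  pose proof (@is_RInt_fct_extend_snd R_NormedModule R_NormedModule f a b I H) as H2.
  pose proof (@is_RInt_scal R_NormedModule _ _ _ (fst c) _ H1) as A1.
  pose proof (@is_RInt_scal R_NormedModule _ _ _ (snd c) _ H2) as A2.
  pose proof (@is_RInt_scal R_NormedModule _ _ _ (fst c) _ H2) as A3.
  pose proof (@is_RInt_scal R_NormedModule _ _ _ (snd c) _ H1) as A4.
  exact (@is_RInt_fct_extend_pair R_NormedModule R_NormedModule (fun t => c * f t)%C a b _ _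
    (@is_RInt_minus R_NormedModule _ _ _ _ _ _ A1 A2)
    (@is_RInt_plus R_NormedModule _ _ _ _ _ _ A3 A4)).
Qed.

Lemma is_CRInt_ext (f g : R -> C) (a b : R) (I : C) : a <= b ->
  (forall t, a <= t <= b -> f t = g t) -> is_CRInt f a b I -> is_CRInt g a b I.
Proof.
  intros Hab H. apply is_RInt_ext. rewrite Rmin_left, Rmax_right by exact Hab.
  intros x Hx; apply H; lra.
Qed.

Lemma is_CRInt_bound (f : R -> C) (a b M : R) (I : C) : a <= b ->
  (forall t, a <= t <= b -> Cmod (f t) <= M) -> is_CRInt f a b I ->
  Cmod I <= (b - a) * M.
Proof.
  intros Hab H HI. rewrite Cmod_norm.
  apply (@norm_RInt_le_const C_R_NormedModule f a b I M Hab); [|exact HI].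
  intros x Hx. generalize (H x Hx). rewrite Cmod_norm. easy.
Qed.

Lemma is_CRInt_const (c : C) (a b : R) : is_CRInt (fun _ => c) a b ((b - a) * c).
Proof.
  rewrite <- RtoC_minus, <- scal_R_Cmult.
  exact (@is_RInt_const C_R_NormedModule a b c).
Qed.

Lemma is_CRInt_derive (g dg : R -> C) (a b : R) : a <= b ->
  (forall t, a <= t <= b -> is_RCderive g t (dg t)) ->
  (forall t, a <= t <= b -> Rcontinuous dg t) ->
  is_CRInt dg a b (g b - g a).
Proof.
  intros Hab H1 H2. apply (@is_RInt_derive C_R_CompleteNormedModule);
    rewrite Rmin_left, Rmax_right by exact Hab; assumption.
Qed.

(** * Integration along segments *)

Lemma convex_ball (a b c : C) (r t : R) : Cmod (a - c) <= r -> Cmod (b - c) <= r ->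
  0 <= t <= 1 -> Cmod (a + t * (b - a) - c) <= r.
Proof.
  intros Ha Hb Ht.
  replace (a + t * (b - a) - c)%C with ((1 - t)%R * (a - c) + t * (b - c))%C
    by (rewrite RtoC_minus; ring).
  eapply Rle_trans; [apply Cmod_triangle|].
  rewrite !Cmod_mult, !Cmod_R, !Rabs_pos_eq by lra.
  pose proof (Cmod_ge_0 (a - c)). nra.
Qed.

Lemma convex_disk (a b : C) (r t : R) : Cmod a <= r -> Cmod b <= r ->
  0 <= t <= 1 -> Cmod (a + t * (b - a)) <= r.
Proof.
  intros Ha Hb Ht. replace (a + t * (b - a))%C with (a + t * (b - a) - 0)%C by ring.
  apply convex_ball; auto; [replace (a - 0)%C with a by ring|replace (b - 0)%C with b by ring];
   assumption.
Qed.

Lemma convex_unit_disk (a b : C) (t : R) : unit_disk a -> unit_disk b ->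
  0 <= t <= 1 -> unit_disk (a + t * (b - a)).
Proof.
  unfold unit_disk. intros Ha Hb Ht. apply Rle_lt_trans with (Rmax (Cmod a) (Cmod b)).
  - apply convex_disk; auto; [apply Rmax_l|apply Rmax_r].
  - apply Rmax_lub_lt; assumption.
Qed.

Definition seg (f : C -> C) (a b : C) : C :=
  ((b - a) * CRInt (fun t => f (a + t * (b - a))%C) 0 1)%C.

Definition disk_continuous (f : C -> C) : Prop :=
  forall z, unit_disk z -> Ccontinuous f z.

Lemma continuous_on_segment (f : C -> C) (a b : C) (t : R) :
  disk_continuous f -> unit_disk a -> unit_disk b -> 0 <= t <= 1 ->
  Rcontinuous (fun t => f (a + t * (b - a))%C) t.
Proof.
  intros Hf Ha Hb Ht. apply (continuous_comp (fun t : R => (a + t * (b - a))%C) f).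
  - exact (is_RCderive_continuous _ _ _ (is_RCderive_affine a (b - a) t)).
  - apply Hf. now apply convex_unit_disk.
Qed.

Lemma seg_correct (f : C -> C) (a b : C) :
  disk_continuous f -> unit_disk a -> unit_disk b ->
  is_CRInt (fun t => f (a + t * (b - a))%C) 0 1 (CRInt (fun t => f (a + t * (b - a))%C) 0 1).
Proof.
  intros Hf Ha Hb. apply CRInt_correct; [lra|]. intros t Ht.
  now apply continuous_on_segment.
Qed.

Lemma seg_unique (f : C -> C) (a b I : C) :
  is_CRInt (fun t => f (a + t * (b - a))%C) 0 1 I -> seg f a b = ((b - a) * I)%C.
Proof.
  intros H. unfold seg. f_equal. exact (@is_RInt_unique C_R_CompleteNormedModule _ _ _ _ H).
Qed.

Lemma is_CRInt_affine_subst (g : R -> C) (u v a b : R) (I : C) : u <> 0 -> a <= b ->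
  is_CRInt g (u * a + v) (u * b + v) I ->
  is_CRInt (fun t => g (u * t + v)) a b (I / u).
Proof.
  intros Hu Hab H.
  pose proof (@is_RInt_comp_lin C_R_NormedModule _ u v a b I H) as L.
  apply (is_CRInt_mult (/ u)%C) in L.
  assert (Hu' : RtoC u <> 0) by (intros E; apply RtoC_inj in E; auto).
  replace (I / u)%C with (/ u * I)%C by (field; exact Hu').
  eapply is_CRInt_ext; [exact Hab| |exact L]. intros t _. cbv beta. rewrite scal_R_Cmult.
  field; exact Hu'.
Qed.

Lemma seg_swap (f : C -> C) (a b : C) :
  disk_continuous f -> unit_disk a -> unit_disk b -> seg f b a = (- seg f a b)%C.
Proof.
  intros Hf Ha Hb. pose proof (seg_correct f a b Hf Ha Hb) as H.
  rewrite (seg_unique f a b _ H).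
  set (I := CRInt _ _ _) in *.
  rewrite (seg_unique f b a I); [ring|].
  apply is_RInt_swap in H.
  pose proof (is_CRInt_affine_subst (fun t => f (a + t * (b - a))%C) (-1) 1 0 1 (- I)%C) as K.
  replace (-1 * 0 + 1) with 1 in K by ring. replace (-1 * 1 + 1) with 0 in K by ring.
  replace I with (- I / (-1)%R)%C by field.
  eapply is_CRInt_ext; [lra| |apply K; [lra|lra|exact H]]. intros t _. cbv beta.
  f_equal. rewrite RtoC_plus, RtoC_mult. ring.
Qed.

Lemma seg_midpoint (f : C -> C) (a b : C) :
  disk_continuous f -> unit_disk a -> unit_disk b ->
  seg f a b = (seg f a ((a + b) / 2) + seg f ((a + b) / 2) b)%C.
Proof.
  intros Hf Ha Hb. set (m := ((a + b) / 2)%C).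
  assert (Eh : RtoC (/ 2) = (/ 2)%C) by (apply RtoC_inv; lra).
  assert (Em : m = (a + (/ 2)%R * (b - a))%C) by (unfold m; rewrite Eh; field).
  assert (Hm : unit_disk m) by (rewrite Em; apply convex_unit_disk; auto; lra).
  pose proof (seg_correct f a m Hf Ha Hm) as H1.
  pose proof (seg_correct f m b Hf Hm Hb) as H2.
  rewrite (seg_unique f a m _ H1), (seg_unique f m b _ H2).
  revert H1 H2. generalize (CRInt (fun t => f (a + t * (m - a))%C) 0 1).
  generalize (CRInt (fun t => f (m + t * (b - m))%C) 0 1). intros J I H1 H2.
  rewrite (seg_unique f a b (I / 2 + J / 2)%C); [unfold m; field|].
  refine (@is_RInt_Chasles C_R_NormedModule _ 0 (/2) 1 _ _ _ _).
  - pose proof (is_CRInt_affine_subst (fun t => f (a + t * (m - a))%C) 2 0 0 (/2) I) as L.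
    replace (2 * 0 + 0) with 0 in L by ring. replace (2 * / 2 + 0) with 1 in L by field.
    eapply is_CRInt_ext; [lra| |apply L; [lra|lra|exact H1]]. intros t _. cbv beta.
    f_equal. rewrite Em, Eh, RtoC_plus, RtoC_mult. field.
  - pose proof (is_CRInt_affine_subst (fun t => f (m + t * (b - m))%C) 2 (-1) (/2) 1 J) as L.
    replace (2 * / 2 + -1) with 0 in L by field. replace (2 * 1 + -1) with 1 in L by ring.
    eapply is_CRInt_ext; [lra| |apply L; [lra|lra|exact H2]]. intros t _. cbv beta.
    f_equal. rewrite Em, Eh, RtoC_plus, RtoC_mult. field.
Qed.

Lemma seg_primitive (F f : C -> C) (a b : C) :
  disk_continuous f -> (forall z, unit_disk z -> is_Cderive F z (f z)) ->
  unit_disk a -> unit_disk b -> seg f a b = (F b - F a)%C.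
Proof.
  intros Hf HF Ha Hb.
  assert (H : is_CRInt (fun t => f (a + t * (b - a)) * (b - a))%C 0 1
     (F (a + 1 * (b - a)) - F (a + 0 * (b - a)))%C).
  { apply (is_CRInt_derive (fun t => F (a + t * (b - a))%C)); [lra| |].
    - intros t Ht. apply is_RCderive_comp; [|apply is_RCderive_affine].
      apply HF. now apply convex_unit_disk.
    - intros t Ht. apply cont_mult; [|apply cont_const]. now apply continuous_on_segment. }
  replace (a + 1 * (b - a))%C with b in H by ring.
  replace (a + 0 * (b - a))%C with a in H by ring.
  rewrite (is_CRInt_unique _ _ _ _ ((b - a) * CRInt (fun t => f (a + t * (b - a))%C) 0 1) H).
  - reflexivity.
  - pose proof (is_CRInt_mult (b - a) _ _ _ _ (seg_correct f a b Hf Ha Hb)) as K.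
    eapply is_CRInt_ext; [lra| |exact K]. intros t _. apply Cmult_comm.
Qed.

Lemma seg_minus (f g : C -> C) (a b : C) :
  disk_continuous f -> disk_continuous g -> unit_disk a -> unit_disk b ->
  seg (fun z => f z - g z)%C a b = (seg f a b - seg g a b)%C.
Proof.
  intros Hf Hg Ha Hb.
  rewrite (seg_unique _ a b _ (is_CRInt_minus _ _ _ _ _ _ (seg_correct f a b Hf Ha Hb)
     (seg_correct g a b Hg Ha Hb))). unfold seg. ring.
Qed.

Lemma seg_bound (f : C -> C) (a b : C) (M : R) :
  disk_continuous f -> unit_disk a -> unit_disk b ->
  (forall t : R, 0 <= t <= 1 -> Cmod (f (a + t * (b - a))%C) <= M) ->
  Cmod (seg f a b) <= M * Cmod (b - a).
Proof.
  intros Hf Ha Hb H. unfold seg. rewrite Cmod_mult, Rmult_comm.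
  apply Rmult_le_compat_r; [apply Cmod_ge_0|].
  replace M with ((1 - 0) * M) by ring.
  eapply is_CRInt_bound; [lra|exact H|now apply seg_correct].
Qed.

(** * Goursat's theorem *)

Record triangle := Triangle { va : C; vb : C; vc : C }.

Definition boundary (f : C -> C) (T : triangle) : C :=
  (seg f (va T) (vb T) + seg f (vb T) (vc T) + seg f (vc T) (va T))%C.

Definition perimeter (T : triangle) : R :=
  Cmod (vb T - va T) + Cmod (vc T - vb T) + Cmod (va T - vc T).

Definition in_disk (r : R) (T : triangle) : Prop :=
  Cmod (va T) <= r /\ Cmod (vb T) <= r /\ Cmod (vc T) <= r.

Definition mid (a b : C) : C := ((a + b) / 2)%C.

Definition quarter1 T := Triangle (va T) (mid (va T) (vb T)) (mid (vc T) (va T)).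
Definition quarter2 T := Triangle (mid (va T) (vb T)) (vb T) (mid (vb T) (vc T)).
Definition quarter3 T := Triangle (mid (vc T) (va T)) (mid (vb T) (vc T)) (vc T).
Definition quarter4 T :=
  Triangle (mid (va T) (vb T)) (mid (vb T) (vc T)) (mid (vc T) (va T)).

(** One of the quarters carries at least a quarter of the boundary integral; which one is
    decided by comparison, the fourth being the default when the other three fail. *)
Definition bisect (f : C -> C) (T : triangle) : triangle :=
  let big T' := Rle_dec (Cmod (boundary f T) / 4) (Cmod (boundary f T')) in
  if big (quarter1 T) then quarter1 T else
  if big (quarter2 T) then quarter2 T else
  if big (quarter3 T) then quarter3 T else quarter4 T.

Lemma mid_disk (r : R) (a b : C) : Cmod a <= r -> Cmod b <= r -> Cmod (mid a b) <= r.
Proof.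
  intros Ha Hb. replace (mid a b) with (a + (/ 2)%R * (b - a))%C.
  - apply convex_disk; auto; lra.
  - unfold mid. rewrite RtoC_inv by lra. field.
Qed.

(** Each inner side is traversed twice, in opposite directions. *)
Lemma boundary_quarters (f : C -> C) (T : triangle) (r : R) : r < 1 ->
  disk_continuous f -> in_disk r T ->
  boundary f T = (boundary f (quarter1 T) + boundary f (quarter2 T)
                + boundary f (quarter3 T) + boundary f (quarter4 T))%C.
Proof.
  intros Hr Hf (Ha & Hb & Hc).
  assert (D : forall z, Cmod z <= r -> unit_disk z) by (intros z; unfold unit_disk; lra).
  destruct T as [a b c]; unfold boundary; cbn in *.
  assert (Hab := mid_disk r a b Ha Hb). assert (Hbc := mid_disk r b c Hb Hc).
  assert (Hca := mid_disk r c a Hc Ha).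
  rewrite (seg_midpoint f a b), (seg_midpoint f b c), (seg_midpoint f c a) by auto.
  fold (mid a b) (mid b c) (mid c a).
  rewrite (seg_swap f (mid a b) (mid b c)), (seg_swap f (mid b c) (mid c a)),
    (seg_swap f (mid c a) (mid a b)) by auto. ring.
Qed.

Lemma Cmod_half (z : C) : Cmod (z / 2) = Cmod z / 2.
Proof.
  rewrite Cmod_div by (intros H; apply RtoC_inj in H; lra).
  rewrite Cmod_R, Rabs_pos_eq by lra. reflexivity.
Qed.

Lemma bisect_spec (f : C -> C) (T : triangle) (r : R) : r < 1 ->
  disk_continuous f -> in_disk r T ->
  in_disk r (bisect f T) /\
  perimeter (bisect f T) = perimeter T / 2 /\
  Cmod (va (bisect f T) - va T) <= perimeter T / 2 /\
  Cmod (boundary f T) / 4 <= Cmod (boundary f (bisect f T)).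
Proof.
  intros Hr Hf HT. pose proof (boundary_quarters f T r Hr Hf HT) as B.
  assert (G : forall T', In T' (quarter1 T :: quarter2 T :: quarter3 T :: quarter4 T :: nil) ->
    in_disk r T' /\ perimeter T' = perimeter T / 2 /\ Cmod (va T' - va T) <= perimeter T / 2).
  { destruct HT as (Ha & Hb & Hc). destruct T as [a b c]. cbn in Ha, Hb, Hc.
    assert (Hab := mid_disk r a b Ha Hb). assert (Hbc := mid_disk r b c Hb Hc).
    assert (Hca := mid_disk r c a Hc Ha).
    assert (E1 : Cmod (mid a b - a) = Cmod (b - a) / 2).
    { rewrite <- Cmod_half. f_equal. unfold mid. field. }
    assert (E1' : Cmod (b - mid a b) = Cmod (b - a) / 2).
    { rewrite <- Cmod_half. f_equal. unfold mid. field. }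
    assert (E2 : Cmod (mid b c - b) = Cmod (c - b) / 2).
    { rewrite <- Cmod_half. f_equal. unfold mid. field. }
    assert (E2' : Cmod (c - mid b c) = Cmod (c - b) / 2).
    { rewrite <- Cmod_half. f_equal. unfold mid. field. }
    assert (E3 : Cmod (mid c a - c) = Cmod (a - c) / 2).
    { rewrite <- Cmod_half. f_equal. unfold mid. field. }
    assert (E3' : Cmod (a - mid c a) = Cmod (a - c) / 2).
    { rewrite <- Cmod_half. f_equal. unfold mid. field. }
    assert (E4 : Cmod (mid b c - mid a b) = Cmod (a - c) / 2).
    { rewrite <- Cmod_half, (Cmod_minus_sym (mid b c)). f_equal. unfold mid. field. }
    assert (E5 : Cmod (mid c a - mid b c) = Cmod (b - a) / 2).
    { rewrite <- Cmod_half, (Cmod_minus_sym (mid c a)). f_equal. unfold mid. field. }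
    assert (E6 : Cmod (mid a b - mid c a) = Cmod (c - b) / 2).
    { rewrite <- Cmod_half, (Cmod_minus_sym (mid a b)). f_equal. unfold mid. field. }
    pose proof (Cmod_ge_0 (b - a)). pose proof (Cmod_ge_0 (c - b)).
    pose proof (Cmod_ge_0 (a - c)).
    pose proof (Cmod_minus_sym (mid c a) a). pose proof (Cmod_minus_sym (mid b c) (mid c a)).
    pose proof (Cmod_minus_sym (mid a b) (mid b c)).
    pose proof (Cmod_minus_sym (mid c a) (mid a b)).
    intros T' [<-|[<-|[<-|[<-|[]]]]]; unfold in_disk, perimeter;
      cbn [va vb vc quarter1 quarter2 quarter3 quarter4];
      (split; [auto|split; [lra|]]); try lra.
    replace (a - a)%C with (RtoC 0) by ring. rewrite Cmod_0. lra. }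
  unfold bisect; cbv zeta.
  repeat match goal with |- context [if ?d then _ else _] => destruct d end;
    match goal with |- in_disk _ ?T' /\ _ => destruct (G T') as (G1 & G2 & G3); [unfold In; auto|] end;
    repeat (split; [assumption|]); try assumption.
  assert (K : Cmod (boundary f T) <= Cmod (boundary f (quarter1 T)) +
     Cmod (boundary f (quarter2 T)) + Cmod (boundary f (quarter3 T)) +
     Cmod (boundary f (quarter4 T))).
  { rewrite B.
    eapply Rle_trans; [apply Cmod_triangle|]. apply Rplus_le_compat_r.
    eapply Rle_trans; [apply Cmod_triangle|]. apply Rplus_le_compat_r.
    apply Cmod_triangle. }
  lra.
Qed.

(** The intervals of centre [x n] and radius [e n] meet pairwise; the limit is the supremum of
    their left ends. *)
Lemma nested_limit (x e : nat -> R) :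
  (forall n m, (n <= m)%nat -> Rabs (x m - x n) <= e n) ->
  exists l, forall n, Rabs (x n - l) <= e n.
Proof.
  intros H.
  assert (U : forall n m, x n - e n <= x m + e m).
  { intros n m. destruct (Nat.le_ge_cases n m) as [L|L].
    - pose proof (H _ _ L) as A. pose proof (H _ _ (le_n m)) as B.
      pose proof (Rabs_pos (x m - x m)). apply Rabs_le_between in A. lra.
    - pose proof (H _ _ L) as A. pose proof (H _ _ (le_n n)) as B.
      pose proof (Rabs_pos (x n - x n)). apply Rabs_le_between in A. lra. }
  destruct (completeness (fun y => exists n, y = x n - e n)) as [l [L1 L2]].
  - exists (x 0%nat + e 0%nat). intros y [n ->]. apply U.
  - exists (x 0%nat - e 0%nat). now exists 0%nat.
  - exists l. intros n. apply Rabs_le_between.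
    assert (x n - e n <= l) by (apply L1; now exists n).
    assert (l <= x n + e n) by (apply L2; intros y [m ->]; apply U). lra.
Qed.

Lemma Re_minus (a b : C) : Re (a - b) = Re a - Re b.
Proof. unfold Cminus. rewrite re_plus, re_opp. ring. Qed.

Lemma Im_minus (a b : C) : Im (a - b) = Im a - Im b.
Proof. unfold Cminus. rewrite im_plus, im_opp. ring. Qed.

Lemma halving_small (p d : R) : 0 < d -> exists n, p / 2 ^ n < d.
Proof.
  intros Hd. destruct (INR_unbounded (p / d)) as [n Hn]. exists n.
  assert (Hp : 0 < 2 ^ n) by (apply pow_lt; lra).
  assert (H : INR n < 2 ^ n) by (rewrite <- (pow_INR 2); apply lt_INR, Nat.pow_gt_lin_r; lia).
  apply Rmult_lt_reg_r with (1 := Hp). unfold Rdiv. rewrite Rmult_assoc, Rinv_l, Rmult_1_r by lra.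
  apply Rmult_lt_reg_r with (/ d); [now apply Rinv_0_lt_compat|].
  replace (d * 2 ^ n * / d) with (2 ^ n) by (field; lra). unfold Rdiv in Hn. lra.
Qed.

Lemma perimeter_ge_0 (T : triangle) : 0 <= perimeter T.
Proof.
  unfold perimeter. pose proof (Cmod_ge_0 (vb T - va T)). pose proof (Cmod_ge_0 (vc T - vb T)).
  pose proof (Cmod_ge_0 (va T - vc T)). lra.
Qed.

Lemma perimeter_vertices (T : triangle) :
  Cmod (vb T - va T) <= perimeter T /\ Cmod (vc T - va T) <= perimeter T.
Proof.
  unfold perimeter. pose proof (Cmod_ge_0 (vb T - va T)). pose proof (Cmod_ge_0 (vc T - vb T)).
  pose proof (Cmod_ge_0 (va T - vc T)). pose proof (Cmod_minus_sym (va T) (vc T)). lra.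
Qed.

(** An affine function has a primitive, so it contributes nothing to the boundary integral
    and only the distance of [f] from its linear approximation at [z] counts. *)
Lemma boundary_linear_approx (f : C -> C) (T : triangle) (r R0 : R) (e : R) (z l : C) : r < 1 ->
  disk_continuous f -> in_disk r T ->
  Cmod (va T - z) <= R0 -> Cmod (vb T - z) <= R0 -> Cmod (vc T - z) <= R0 ->
  (forall y, Cmod (y - z) <= R0 -> Cmod (f y - f z - l * (y - z)) <= e) ->
  Cmod (boundary f T) <= e * perimeter T.
Proof.
  intros Hr Hf (Ha & Hb & Hc) Da Db Dc H.
  set (F := fun y : C => (f z * y + l * ((y - z) * (y - z)) / 2)%C).
  set (g := fun y : C => (f z + l * (y - z))%C).
  assert (dg : forall y, Ccontinuous g y).
  { intros y. apply cont_plus; [apply cont_const|]. apply cont_mult; [apply cont_const|].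
    apply cont_minus; [apply continuous_id|apply cont_const]. }
  assert (dF : forall y, is_Cderive F y (g y)).
  { intros y. unfold F, g.
    replace (f z + l * (y - z))%C with (f z + l * (y - z + (y - z)) / 2)%C by field.
    apply (Caratheodory_all _ (fun w => f z + l * (w - z + (y - z)) / 2)%C).
    - apply cont_plus; [apply cont_const|]. apply cont_mult; [|apply cont_const].
      apply cont_mult; [apply cont_const|]. apply cont_plus; [|apply cont_const].
      apply cont_minus; [apply continuous_id|apply cont_const].
    - intros w. field. }
  assert (D : forall w, Cmod w <= r -> unit_disk w) by (intros w; unfold unit_disk; lra).
  apply D in Ha, Hb, Hc.
  assert (S : forall p q, unit_disk p -> unit_disk q -> Cmod (p - z) <= R0 -> Cmod (q - z) <= R0 ->
    Cmod (seg f p q - (F q - F p)) <= e * Cmod (q - p)).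
  { intros p q Hp Hq Dp Dq.
    rewrite <- (seg_primitive F g p q), <- seg_minus by (auto; intros w _; auto).
    apply seg_bound; auto.
    - intros w Hw. apply cont_minus; auto.
    - intros t Ht. unfold g.
      replace (f (p + t * (q - p)) - (f z + l * (p + t * (q - p) - z)))%C
        with (f (p + t * (q - p)) - f z - l * (p + t * (q - p) - z))%C by ring.
      apply H. now apply convex_ball. }
  replace (boundary f T) with
    (seg f (va T) (vb T) - (F (vb T) - F (va T)) + (seg f (vb T) (vc T) - (F (vc T) - F (vb T)))
     + (seg f (vc T) (va T) - (F (va T) - F (vc T))))%C by (unfold boundary; ring).
  unfold perimeter. rewrite !Rmult_plus_distr_l.
  eapply Rle_trans; [apply Cmod_triangle|]. apply Rplus_le_compat; [|now apply S].
  eapply Rle_trans; [apply Cmod_triangle|]. apply Rplus_le_compat; now apply S.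
Qed.

Lemma holomorphic_continuous (f : C -> C) : holomorphic_on unit_disk f -> disk_continuous f.
Proof.
  intros H z Hz. destruct (H z Hz) as [l Hl]. exact (is_Cderive_continuous _ _ _ Hl).
Qed.

(** Repeated bisection shrinks the triangle to a point [z], where [f] is affine up to
    [e |y - z|]. Both the lower bound [|boundary| / 4^n] and the upper bound, of order
    [e perimeter^2], scale like [4^-n], so the boundary integral is at most a multiple of
    [e]. *)
Theorem goursat (f : C -> C) (T : triangle) (r : R) : r < 1 ->
  holomorphic_on unit_disk f -> in_disk r T -> boundary f T = 0.
Proof.
  intros Hr Hf HT. pose proof (holomorphic_continuous _ Hf) as Cf.
  set (Tn := fun n => Nat.iter n (bisect f) T).
  set (p := perimeter T). pose proof (perimeter_ge_0 T) as Hp. fold p in Hp.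
  assert (I : forall n, in_disk r (Tn n) /\ perimeter (Tn n) = p / 2 ^ n /\
     Cmod (boundary f T) / 4 ^ n <= Cmod (boundary f (Tn n)) /\
     Cmod (va (Tn (S n)) - va (Tn n)) <= perimeter (Tn n) / 2).
  { assert (J : forall n, in_disk r (Tn n) /\ perimeter (Tn n) = p / 2 ^ n /\
     Cmod (boundary f T) / 4 ^ n <= Cmod (boundary f (Tn n))).
    { induction n as [|n (A1 & A2 & A3)].
      - cbn. split; [exact HT|]. split; [unfold p; field|lra].
      - destruct (bisect_spec f (Tn n) r Hr Cf A1) as (B1 & B2 & B3 & B4).
        change (Tn (S n)) with (bisect f (Tn n)). split; [exact B1|].
        assert (0 < 2 ^ n) by (apply pow_lt; lra). assert (0 < 4 ^ n) by (apply pow_lt; lra).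
        split.
        + rewrite B2, A2. cbn. field. lra.
        + eapply Rle_trans; [|exact B4].
          replace (Cmod (boundary f T) / 4 ^ S n) with (Cmod (boundary f T) / 4 ^ n / 4)
            by (cbn; field; lra). lra. }
    intros n. destruct (J n) as (A1 & A2 & A3).
    destruct (bisect_spec f (Tn n) r Hr Cf A1) as (B1 & B2 & B3 & B4). auto. }
  assert (P2 : forall n, 0 < 2 ^ n) by (intros n; apply pow_lt; lra).
  (* The first vertices move by less than the perimeter lost, which telescopes. *)
  assert (D : forall n k, Cmod (va (Tn (n + k)%nat) - va (Tn n))
     <= perimeter (Tn n) - perimeter (Tn (n + k)%nat)).
  { intros n k. induction k as [|k IH].
    - rewrite Nat.add_0_r. replace (va (Tn n) - va (Tn n))%C with (RtoC 0) by ring.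
      rewrite Cmod_0. lra.
    - rewrite Nat.add_succ_r. destruct (I (n + k)%nat) as (_ & A2 & _ & A4).
      destruct (I (S (n + k))) as (_ & B2 & _ & _).
      replace (va (Tn (S (n + k))) - va (Tn n))%C with
       (va (Tn (S (n + k))) - va (Tn (n + k)%nat) + (va (Tn (n + k)%nat) - va (Tn n)))%C by ring.
      eapply Rle_trans; [apply Cmod_triangle|].
      assert (perimeter (Tn (S (n + k))) = perimeter (Tn (n + k)%nat) / 2).
      { rewrite A2, B2. cbn. field. pose proof (P2 (n + k)%nat). lra. }
      lra. }
  assert (D' : forall n m, (n <= m)%nat -> Cmod (va (Tn m) - va (Tn n)) <= p / 2 ^ n).
  { intros n m L. replace m with (n + (m - n))%nat by lia.
    destruct (I n) as (_ & <- & _). eapply Rle_trans; [apply D|].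
    pose proof (perimeter_ge_0 (Tn (n + (m - n))%nat)). lra. }
  assert (Ri : forall w, Rabs (Re w) <= Cmod w /\ Rabs (Im w) <= Cmod w).
  { intros w. pose proof (Rmax_Cmod w) as M. split; (eapply Rle_trans; [|exact M]);
    [apply Rmax_l|apply Rmax_r]. }
  destruct (nested_limit (fun n => Re (va (Tn n))) (fun n => p / 2 ^ n)) as [x Hx].
  { intros n m L. eapply Rle_trans; [|apply (D' n m L)].
    rewrite <- Re_minus.
    exact (proj1 (Ri _)). }
  destruct (nested_limit (fun n => Im (va (Tn n))) (fun n => p / 2 ^ n)) as [y Hy].
  { intros n m L. eapply Rle_trans; [|apply (D' n m L)].
    rewrite <- Im_minus.
    exact (proj2 (Ri _)). }
  set (z := (x, y) : C).
  assert (Hz : forall n, Cmod (va (Tn n) - z) <= 2 * (p / 2 ^ n)).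
  { intros n. eapply Rle_trans; [apply Cmod_le_abs|]. specialize (Hx n). specialize (Hy n).
    cbv beta in Hx, Hy.
    rewrite Re_minus, Im_minus. unfold z; cbn [Re Im fst snd]. lra. }
  assert (Dz : unit_disk z).
  { destruct (halving_small (2 * p) (1 - r)) as [n Hn]; [lra|].
    specialize (Hz n). destruct (I n) as ((A & _) & _).
    rewrite Cmod_minus_sym in Hz. pose proof (Cmod_triangle_minus z (va (Tn n))).
    unfold unit_disk. unfold Rdiv in *. lra. }
  destruct (Hf z Dz) as [l Hl].
  assert (K : forall e, 0 < e -> Cmod (boundary f T) <= e).
  { intros e He.
    (* Vertices of the n-th triangle are within [3 p / 2^n] of [z]: this is the factor 3, and
       [+ 1] covers a triangle reduced to a point. *)
    set (e' := e / (3 * p * p + 1)).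
    assert (Hpp : 0 <= p * p) by nra.
    assert (He' : 0 < e') by (apply Rdiv_lt_0_compat; lra).
    pose proof (proj1 (is_Cderive_Cmod _ _ _) Hl e' He') as L.
    apply locally_Cmod in L. destruct L as (d & Hd & L).
    destruct (halving_small (3 * p) d Hd) as [n Hn].
    destruct (I n) as (A1 & A2 & A3 & _).
    specialize (Hz n). pose proof (perimeter_vertices (Tn n)) as [V1 V2].
    pose proof (perimeter_ge_0 (Tn n)) as V3.
    assert (Tr : forall v, Cmod (v - va (Tn n)) <= perimeter (Tn n) ->
      Cmod (v - z) <= 3 * (p / 2 ^ n)).
    { intros v Hv. replace (v - z)%C with (v - va (Tn n) + (va (Tn n) - z))%C by ring.
      eapply Rle_trans; [apply Cmod_triangle|]. lra. }
    assert (B : Cmod (boundary f (Tn n)) <= (e' * (3 * (p / 2 ^ n))) * perimeter (Tn n)).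
    { apply boundary_linear_approx with (r := r) (R0 := 3 * (p / 2 ^ n)) (z := z) (l := l); auto.
      - lra.
      - intros w Hw. eapply Rle_trans; [apply L; unfold Rdiv in *; lra|].
        apply Rmult_le_compat_l; lra. }
    rewrite A2 in B.
    assert (E4 : 4 ^ n = 2 ^ n * 2 ^ n) by (rewrite <- Rpow_mult_distr; f_equal; ring).
    pose proof (P2 n) as P.
    assert (Cmod (boundary f T) <= 3 * e' * (p * p)).
    { assert (P4 : 0 < 4 ^ n) by (apply pow_lt; lra).
      apply Rmult_le_reg_r with (/ 4 ^ n); [now apply Rinv_0_lt_compat|].
      eapply Rle_trans; [exact A3|]. eapply Rle_trans; [exact B|].
      rewrite E4. right. field. lra. }
    eapply Rle_trans; [eassumption|].
    assert (E : e' * (3 * p * p + 1) = e) by (unfold e'; field; nra). nra. }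
  apply Cmod_eq_0. apply Rle_antisym; [|apply Cmod_ge_0].
  apply le_epsilon. intros e He. rewrite Rplus_0_l. now apply K.
Qed.

(** * Primitives *)

Theorem holomorphic_primitive (f : C -> C) : holomorphic_on unit_disk f ->
  exists F, forall z, unit_disk z -> is_Cderive F z (f z).
Proof.
  intros Hf. pose proof (holomorphic_continuous _ Hf) as Cf.
  exists (seg f 0). intros z Hz.
  apply is_Cderive_Cmod. intros e He.
  pose proof (proj1 (continuous_Cmod _ _ _) (Cf z Hz) e He) as L.
  apply locally_Cmod in L. destruct L as (d & Hd & L).
  apply locally_Cmod. unfold unit_disk in Hz.
  exists (Rmin d (1 - Cmod z)). split; [apply Rmin_glb_lt; lra|].
  intros y Hy. pose proof (Rmin_l d (1 - Cmod z)). pose proof (Rmin_r d (1 - Cmod z)).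
  pose proof (Cmod_triangle_minus y z).
  assert (D0 : unit_disk 0) by (unfold unit_disk; rewrite Cmod_0; lra).
  assert (Dy : unit_disk y) by (unfold unit_disk; lra).
  assert (G : boundary f (Triangle 0 z y) = 0).
  { apply goursat with (r := Rmax (Cmod z) (Cmod y)); auto.
    - apply Rmax_lub_lt; [lra|exact Dy].
    - unfold in_disk; cbn [va vb vc]. split; [rewrite Cmod_0|split; [apply Rmax_l|apply Rmax_r]].
      eapply Rle_trans; [apply Cmod_ge_0|apply Rmax_l]. }
  unfold boundary in G; cbn [va vb vc] in G. rewrite (seg_swap f 0 y) in G by auto.
  assert (S : (f z * (y - z))%C = seg (fun _ => f z) z y).
  { rewrite (seg_unique (fun _ => f z) z y ((1 - 0) * f z)%C); [ring|]. apply is_CRInt_const. }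
  assert (Cz : disk_continuous (fun _ => f z)) by (intros w _; apply cont_const).
  replace (seg f 0 y - seg f 0 z - f z * (y - z))%C with (seg (fun w => f w - f z) z y)%C.
  2:{ rewrite (seg_minus f (fun _ => f z)), S by auto.
      assert (E : seg f z y = (seg f 0 y - seg f 0 z)%C).
      { apply Ceq_minus. etransitivity; [|exact G]. ring. }
      rewrite E. ring. }
  apply seg_bound; auto.
  - intros w Hw. apply cont_minus; auto.
  - intros t Ht. left. apply L.
    assert (Cmod (z + t * (y - z) - z) <= Cmod (y - z)); [|lra].
    apply convex_ball; [|lra|exact Ht].
    replace (z - z)%C with (RtoC 0) by ring. rewrite Cmod_0. apply Cmod_ge_0.
Qed.

(** * Compactness *)

(** Lebesgue numbers in gauge form: if every point of the closed disk has a scale on which [Q]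
    is good, then one lower bound on the scales serves all points of the disk. *)
Lemma disk_compactness (r : R) (Q : C -> R -> Prop) :
  (forall c, Cmod c <= r -> exists d, 0 < d /\ Q c d) ->
  exists d0, 0 < d0 /\ forall z, Cmod z <= r ->
    exists c d, Q c d /\ d0 <= d /\ Cmod (z - c) < d.
Proof.
  intros H.
  (* The compactness of squares is used, so a gauge is needed off the disk too; there it is
     small enough that no point of the disk is close to such a centre. *)
  assert (G : forall c : C, exists d : posreal, (Cmod c <= r -> Q c d) /\
     (r < Cmod c -> d <= Cmod c - r)).
  { intros c. destruct (Rle_dec (Cmod c) r) as [L|L].
    - destruct (H c L) as (d & Hd & HQ). exists (mkposreal d Hd). split; [easy|lra].
    - assert (Hd : 0 < Cmod c - r) by lra. exists (mkposreal _ Hd). cbn. split; lra. }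
  pose (gauge := fun c => proj1_sig (constructive_indefinite_description _ (G c))).
  assert (Hg : forall c, (Cmod c <= r -> Q c (gauge c)) /\ (r < Cmod c -> gauge c <= Cmod c - r)).
  { intros c. exact (proj2_sig (constructive_indefinite_description _ (G c))). }
  destruct (compactness_value_2d (- r) r (- r) r
    (fun x y => pos_div_2 (gauge (x, y)))) as [d Hd].
  exists d. split; [apply cond_pos|]. intros z Hz.
  assert (Hx : - r <= fst z <= r /\ - r <= snd z <= r).
  { pose proof (Rmax_Cmod z) as M.
    pose proof (Rmax_l (Rabs (fst z)) (Rabs (snd z))).
    pose proof (Rmax_r (Rabs (fst z)) (Rabs (snd z))).
    split; apply Rabs_le_between; lra. }
  apply NNPP. intros N. apply (Hd _ _ (proj1 Hx) (proj2 Hx)).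
  intros (u & v & _ & _ & A & B & D). cbn in A, B, D. apply N.
  pose proof (cond_pos (gauge (u, v))).
  assert (K : Cmod (z - (u, v)) < gauge (u, v)).
  { eapply Rle_lt_trans; [apply Cmod_le_abs|]. rewrite Re_minus, Im_minus.
    cbn [Re Im fst snd]. unfold Re, Im. lra. }
  exists (u, v), (gauge (u, v)). split; [|split; [lra|exact K]].
  apply Hg. destruct (Rle_dec (Cmod (u, v)) r) as [L|L]; [exact L|].
  pose proof (proj2 (Hg (u, v)) ltac:(lra)).
  pose proof (Cmod_triangle_minus (u, v) z). rewrite Cmod_minus_sym in K. lra.
Qed.

(** The remainder is the integral of [f - f x] along the segment from [x] to [x + h], so this
    is the uniform continuity of [f] near a compact disk. *)
Lemma uniform_differentiability (F f : C -> C) (r e : R) : r < 1 -> 0 < e ->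
  disk_continuous f -> (forall z, unit_disk z -> is_Cderive F z (f z)) ->
  exists d, 0 < d /\ forall x h : C, Cmod x <= r -> Cmod h < d ->
    Cmod (F (x + h)%C - F x - f x * h) <= e * Cmod h.
Proof.
  intros Hr He Cf HF.
  destruct (disk_compactness r (fun c d => forall y, Cmod (y - c) < 2 * d ->
     unit_disk y /\ Cmod (f y - f c) < e / 2)) as (d & Hd & K).
  { intros c Hc. assert (Dc : unit_disk c) by (unfold unit_disk; lra).
    assert (He2 : 0 < e / 2) by lra.
    pose proof (proj1 (continuous_Cmod _ _ _) (Cf c Dc) _ He2) as L.
    apply locally_Cmod in L. destruct L as (d & Hd & L).
    assert (0 < Rmin d (1 - r)) by (apply Rmin_glb_lt; lra).
    exists (Rmin d (1 - r) / 2). split; [lra|].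
    intros y Hy. pose proof (Rmin_l d (1 - r)). pose proof (Rmin_r d (1 - r)).
    split; [|apply L; lra]. unfold unit_disk. pose proof (Cmod_triangle_minus y c). lra. }
  exists d. split; [exact Hd|]. intros x h Hx Hh.
  destruct (K x Hx) as (c & d' & HQ & Hd' & Hc).
  set (s := Rmax (Cmod (x - c)) (Cmod (x + h - c))).
  assert (Hs : s < 2 * d').
  { apply Rmax_lub_lt; [lra|]. replace (x + h - c)%C with (x - c + h)%C by ring.
    eapply Rle_lt_trans; [apply Cmod_triangle|]. lra. }
  assert (Dx : unit_disk x) by (apply HQ; lra).
  assert (Dh : unit_disk (x + h)).
  { apply HQ. eapply Rle_lt_trans; [apply Rmax_r|exact Hs]. }
  assert (S : (f x * h)%C = seg (fun _ => f x) x (x + h)).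
  { rewrite (seg_unique (fun _ => f x) x (x + h) ((1 - 0) * f x)%C); [ring|]. apply is_CRInt_const. }
  assert (Cx : disk_continuous (fun _ => f x)) by (intros w _; apply cont_const).
  rewrite S, <- (seg_primitive F f), <- seg_minus by auto.
  replace (Cmod h) with (Cmod (x + h - x)) by (f_equal; ring).
  apply seg_bound; auto.
  - intros w Hw. apply cont_minus; auto.
  - intros t Ht.
    assert (Y : Cmod (x + t * (x + h - x) - c) < 2 * d').
    { eapply Rle_lt_trans; [|exact Hs]. apply convex_ball; [apply Rmax_l|apply Rmax_r|exact Ht]. }
    apply HQ in Y. destruct Y as [_ Y].
    assert (X : Cmod (f x - f c) < e / 2) by (apply HQ; lra).
    rewrite Cmod_minus_sym in X.
    match goal with |- Cmod (?u - ?v) <= _ =>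
      replace (u - v)%C with ((u - f c) + (f c - v))%C by ring end.
    eapply Rle_trans; [apply Cmod_triangle|]. lra.
Qed.

(** * Integrals over circles *)

Definition circle (r t : R) : C := (r * cos t, r * sin t).

Lemma Cmod_circle (r t : R) : 0 <= r -> Cmod (circle r t) = r.
Proof.
  intros Hr. unfold Cmod, circle; cbn [fst snd].
  replace ((r * cos t) ^ 2 + (r * sin t) ^ 2) with (r ^ 2 * (Rsqr (sin t) + Rsqr (cos t)))
    by (unfold Rsqr; ring).
  rewrite sin2_cos2, Rmult_1_r. now apply sqrt_pow2.
Qed.

Lemma circle_period (r : R) : circle r (2 * PI) = circle r 0.
Proof. unfold circle. rewrite cos_2PI, sin_2PI, cos_0, sin_0. reflexivity. Qed.

Lemma is_RCderive_circle (r t : R) : is_RCderive (circle r) t (Ci * circle r t).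
Proof.
  replace (Ci * circle r t)%C with ((- (r * sin t), r * cos t) : C).
  - apply is_RCderive_pair; auto_derive; auto; ring.
  - apply injective_projections; cbn; ring.
Qed.

Lemma continuous_circle (r t : R) : Rcontinuous (circle r) t.
Proof. exact (is_RCderive_continuous _ _ _ (is_RCderive_circle r t)). Qed.

Lemma circle_minus_lower (r t : R) (z : C) : 0 <= r -> r - Cmod z <= Cmod (circle r t - z).
Proof.
  intros Hr. pose proof (Cmod_triangle_minus (circle r t) z) as H.
  rewrite Cmod_circle in H by exact Hr. exact H.
Qed.

Lemma circle_minus_neq (r t : R) (z : C) : Cmod z < r -> (circle r t - z)%C <> 0.
Proof.
  intros H. pose proof (Cmod_ge_0 z). apply Cmod_gt_0.
  pose proof (circle_minus_lower r t z). lra.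
Qed.

Lemma two_PI_pos : 0 < 2 * PI.
Proof. pose proof PI_RGT_0. lra. Qed.

Lemma continuous_bounded (g : R -> C) (a b : R) : a <= b ->
  (forall t, a <= t <= b -> Rcontinuous g t) ->
  exists M, 0 < M /\ forall t, a <= t <= b -> Cmod (g t) <= M.
Proof.
  intros Hab H. destruct (continuity_ab_maj (fun t => Cmod (g t)) a b Hab) as (m & Hm & _).
  - intros t Ht. apply continuity_pt_filterlim.
    apply (continuous_comp g Cmod); [now apply H|].
    apply (filterlim_ext (fun x : C => @norm R_AbsRing C_R_NormedModule x)); [intros x; symmetry; exact (Cmod_norm x)|].
    rewrite (Cmod_norm (g t)). exact (@filterlim_norm R_AbsRing C_R_NormedModule (g t)).
  - exists (Cmod (g m) + 1). pose proof (Cmod_ge_0 (g m)). split; [lra|].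
    intros t Ht. specialize (Hm t Ht). cbv beta in Hm. lra.
Qed.

(** ** Cauchy transforms *)

(** As [d zeta = i zeta dt] on the circle, for [n = 1] and [phi t = f zeta * zeta] this is [2 pi]
    times the Cauchy integral of [f] at [z]. The exponent is kept general because derivation
    in [z] raises it. *)
Definition transform (r : R) (phi : R -> C) (n : nat) (z : C) : C :=
  CRInt (fun t => phi t * (/ (circle r t - z)) ^ n)%C 0 (2 * PI).

Lemma cont_Cpow {U : UniformSpace} (f : U -> C) (n : nat) x :
  @continuous U C_UniformSpace f x -> @continuous U C_UniformSpace (fun y => (f y) ^ n)%C x.
Proof.
  intros H. induction n as [|n IH]; [apply cont_const|]. now apply cont_mult.
Qed.

Definition circle_weight (phi : R -> C) : Prop :=
  forall t, 0 <= t <= 2 * PI -> Rcontinuous phi t.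

Lemma transform_correct (r : R) (phi : R -> C) (n : nat) (z : C) :
  circle_weight phi -> Cmod z < r ->
  is_CRInt (fun t => phi t * (/ (circle r t - z)) ^ n)%C 0 (2 * PI) (transform r phi n z).
Proof.
  intros Hphi Hz. pose proof two_PI_pos. apply CRInt_correct; [lra|]. intros t Ht.
  apply cont_mult; [now apply Hphi|]. apply cont_Cpow. apply cont_inv.
  - now apply circle_minus_neq.
  - apply cont_minus; [apply continuous_circle|apply cont_const].
Qed.

Lemma transform_unique (r : R) (phi : R -> C) (n : nat) (z I : C) :
  is_CRInt (fun t => phi t * (/ (circle r t - z)) ^ n)%C 0 (2 * PI) I -> transform r phi n z = I.
Proof. intros H. exact (@is_RInt_unique C_R_CompleteNormedModule _ _ _ _ H). Qed.

(** First-order Taylor formula for [(zeta - z)^-n] with quadratic remainder, uniform as long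
    as [zeta - z] stays away from [0]: with [u = 1 / (zeta - z)] and [v = 1 / (zeta - z - h)],
    the relation [v - u = h u v] is all that is used. *)
Lemma inverse_power_taylor (M : R) (n : nat) : 0 <= M -> exists K, 0 <= K /\
  forall u v h : C, Cmod u <= M -> Cmod v <= M -> (v - u)%C = (h * u * v)%C ->
    Cmod (v ^ n - u ^ n - INR n * u ^ (S n) * h) <= K * (Cmod h * Cmod h).
Proof.
  intros HM. induction n as [|n (K & HK & IH)].
  - exists 0. split; [lra|]. intros u v h _ _ _. cbn [Cpow INR].
    replace (1 - 1 - 0 * (u * 1) * h)%C with (RtoC 0) by ring. rewrite Cmod_0. lra.
  - exists (M * K + INR (S n) * (M ^ (S (S n)) * M)). pose proof (pos_INR (S n)) as Pn.
    assert (PM : 0 <= M ^ (S (S n)) * M) by (apply Rmult_le_pos; [now apply pow_le|lra]).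
    split; [nra|]. intros u v h Hu Hv E.
    replace (v ^ S n - u ^ S n - INR (S n) * u ^ S (S n) * h)%C with
      (v * (v ^ n - u ^ n - INR n * u ^ S n * h)
        + INR (S n) * (u ^ (S (S n)) * v) * (h * h))%C.
    2:{ rewrite S_INR, RtoC_plus, !Cpow_S.
        generalize (u ^ n)%C (v ^ n)%C (RtoC (INR n)). intros U V N. apply Ceq_minus.
        transitivity ((h * u * v - (v - u)) * (U + (N + 1) * h * (u * U)))%C; [ring|].
        rewrite E. ring. }
    eapply Rle_trans; [apply Cmod_triangle|]. rewrite !Cmod_mult, Cmod_R, Cmod_pow, Rabs_pos_eq by auto.
    rewrite Rmult_plus_distr_r. pose proof (Cmod_ge_0 h). apply Rplus_le_compat.
    + rewrite Rmult_assoc. apply Rmult_le_compat; try apply Cmod_ge_0; auto.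
    + apply Rmult_le_compat_r; [nra|]. apply Rmult_le_compat_l; [auto|].
      apply Rmult_le_compat; auto; try apply Cmod_ge_0; [apply pow_le, Cmod_ge_0|].
      apply pow_incr. split; [apply Cmod_ge_0|auto].
Qed.

Lemma transform_derive (r : R) (phi : R -> C) (n : nat) (z : C) :
  circle_weight phi -> Cmod z < r ->
  is_Cderive (transform r phi n) z (INR n * transform r phi (S n) z).
Proof.
  intros Hphi Hz. pose proof two_PI_pos as HPI. pose proof (Cmod_ge_0 z) as Pz.
  destruct (continuous_bounded phi 0 (2 * PI)) as (P & HP & Bphi); [lra|exact Hphi|].
  set (M := 2 / (r - Cmod z)).
  assert (HM : 0 < M) by (apply Rdiv_lt_0_compat; lra).
  assert (EM : / M = (r - Cmod z) / 2) by (unfold M; field; lra).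
  destruct (inverse_power_taylor M n) as (K & HK & T); [lra|].
  apply is_Cderive_Cmod. intros e He.
  set (B := 2 * PI * (P * K)).
  assert (HB : 0 <= B) by (unfold B; apply Rmult_le_pos; [lra|apply Rmult_le_pos; lra]).
  apply locally_Cmod. exists (Rmin (/ M) (e / (B + 1))). split.
  { apply Rmin_glb_lt; [now apply Rinv_0_lt_compat|apply Rdiv_lt_0_compat; lra]. }
  intros y Hy. pose proof (Rmin_l (/ M) (e / (B + 1))) as m1.
  pose proof (Rmin_r (/ M) (e / (B + 1))) as m2.
  pose proof (Cmod_triangle_minus y z) as Ty.
  assert (Hyr : Cmod y <= r - / M) by lra.
  assert (0 < / M) by now apply Rinv_0_lt_compat.
  assert (Iy : forall w t, Cmod w <= r - / M -> Cmod (/ (circle r t - w)) <= M).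
  { intros w t Hw. rewrite Cmod_inv by (apply circle_minus_neq; lra).
    rewrite <- (Rinv_inv M). apply Rinv_le_contravar; [lra|].
    pose proof (circle_minus_lower r t w). lra. }
  pose proof (transform_correct r phi n y Hphi ltac:(lra)) as Iy1.
  pose proof (transform_correct r phi n z Hphi Hz) as Iz1.
  pose proof (transform_correct r phi (S n) z Hphi Hz) as Iz2.
  apply (is_CRInt_mult (INR n * (y - z))) in Iz2.
  pose proof (is_CRInt_minus _ _ _ _ _ _ (is_CRInt_minus _ _ _ _ _ _ Iy1 Iz1) Iz2) as D.
  replace (INR n * (y - z) * transform r phi (S n) z)%C
    with (INR n * transform r phi (S n) z * (y - z))%C in D by ring.
  apply is_CRInt_bound with (M := P * (K * (Cmod (y - z) * Cmod (y - z)))) in D; [|lra|].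
  - eapply Rle_trans; [exact D|].
    rewrite Rminus_0_r.
    replace (2 * PI * (P * (K * (Cmod (y - z) * Cmod (y - z)))))
      with (B * Cmod (y - z) * Cmod (y - z)) by (unfold B; ring).
    apply Rmult_le_compat_r; [apply Cmod_ge_0|].
    assert (E : e / (B + 1) * (B + 1) = e) by (field; lra).
    pose proof (Cmod_ge_0 (y - z)). nra.
  - intros t Ht. cbv beta.
    assert (Ny : (circle r t - y)%C <> 0) by (apply circle_minus_neq; lra).
    assert (Nz : (circle r t - z)%C <> 0) by (apply circle_minus_neq; lra).
    set (u := (/ (circle r t - z))%C). set (v := (/ (circle r t - y))%C).
    replace (phi t * v ^ n - phi t * u ^ n - INR n * (y - z) * (phi t * u ^ S n))%C
      with (phi t * (v ^ n - u ^ n - INR n * u ^ S n * (y - z)))%C by ring.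
    rewrite Cmod_mult. apply Rmult_le_compat; try apply Cmod_ge_0; [now apply Bphi|].
    apply T; [apply Iy; lra|apply Iy; lra|]. unfold u, v. field. auto.
Qed.

Lemma circle_integral_derive (r : R) (g dg : C -> C) :
  (forall t, is_Cderive g (circle r t) (dg (circle r t))) ->
  (forall t, Ccontinuous dg (circle r t)) ->
  is_CRInt (fun t => dg (circle r t) * (Ci * circle r t))%C 0 (2 * PI) 0.
Proof.
  intros Hg Hd. pose proof two_PI_pos.
  replace (RtoC 0) with (g (circle r (2 * PI)) - g (circle r 0))%C
    by (rewrite circle_period; ring).
  apply (is_CRInt_derive (fun t => g (circle r t))); [lra| |].
  - intros t _. apply is_RCderive_comp; [apply Hg|apply is_RCderive_circle].
  - intros t _. apply cont_mult.
    + apply (continuous_comp (circle r) dg); [apply continuous_circle|apply Hd].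
    + apply cont_mult; [apply cont_const|apply continuous_circle].
Qed.

Lemma RCderive_zero_const (g : R -> C) :
  (forall t, 0 <= t <= 1 -> is_RCderive g t 0) -> g 0 = g 1.
Proof.
  intros H. apply (@eq_is_derive C_R_NormedModule g 0 1); [exact H|lra].
Qed.

(** The winding number of the circle about an interior point: its derivative in [z] is the
    integral of the [t]-derivative of [i / (zeta - z)], which vanishes by periodicity, and it
    is [2 pi] at the centre. *)
Lemma winding_integral (r : R) (z : C) : Cmod z < r -> transform r (circle r) 1 z = RtoC (2 * PI).
Proof.
  intros Hz. pose proof (Cmod_ge_0 z) as Pz. pose proof two_PI_pos.
  assert (W : circle_weight (circle r)) by (intros t _; apply continuous_circle).
  assert (Z : forall w, Cmod w < r -> transform r (circle r) 2 w = 0).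
  { intros w Hw. apply transform_unique.
    replace (RtoC 0) with (Ci * 0)%C by ring.
    eapply is_CRInt_ext; [lra| |apply is_CRInt_mult].
    2:{ apply (circle_integral_derive r (fun y => / (y - w))%C (fun y => - (1) * (/ (y - w)) ^ 2)%C).
        - intros t. pose proof (circle_minus_neq r t w Hw).
          replace (- (1) * (/ (circle r t - w)) ^ 2)%C
            with (- (1 - 0) / ((circle r t - w) * (circle r t - w)))%C by (cbn [Cpow]; field; auto).
          apply (is_Cderive_inv (fun y => y - w)%C); [auto|].
          apply is_Cderive_minus; [apply is_Cderive_id|apply is_Cderive_const].
        - intros t. pose proof (circle_minus_neq r t w Hw).
          apply cont_mult; [apply cont_const|]. apply cont_Cpow, cont_inv; [auto|].
          apply cont_minus; [apply continuous_id|apply cont_const]. }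
    intros t _. cbv beta.
    transitivity (- (Ci * Ci) * (circle r t * (/ (circle r t - w)) ^ 2))%C; [ring|].
    replace (Ci * Ci)%C with (- (1))%C by (apply injective_projections; cbn; ring). ring. }
  assert (E : transform r (circle r) 1 (0 + 0 * z)%C = transform r (circle r) 1 (0 + 1 * z)%C).
  { apply (RCderive_zero_const (fun s => transform r (circle r) 1 (0 + s * z)%C)).
    intros s Hs.
    assert (Cmod (0 + s * z)%C < r).
    { rewrite Cplus_0_l, Cmod_mult, Cmod_R, Rabs_pos_eq by lra. nra. }
    pose proof (is_RCderive_comp _ _ _ _ _
      (transform_derive r (circle r) 1 (0 + s * z) W ltac:(assumption))
      (is_RCderive_affine 0 z s)) as D.
    rewrite Z in D by assumption. replace (INR 1 * 0 * z)%C with (RtoC 0) in D by ring.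
    exact D. }
  replace (0 + 1 * z)%C with z in E by ring. rewrite <- E.
  apply transform_unique. replace (RtoC (2 * PI)) with ((RtoC (2 * PI) - 0) * 1)%C by ring.
  eapply is_CRInt_ext; [lra| |apply is_CRInt_const].
  intros t _. cbn [Cpow].
  assert (circle r t - 0 <> 0)%C by (apply circle_minus_neq; rewrite Cmod_0; lra).
  replace (0 + 0 * z)%C with (RtoC 0) by ring. field.
  replace (circle r t) with (circle r t - 0)%C by ring. assumption.
Qed.

(** Contract the circle to [z] along [gam s t = z + s (zeta - z)]. The integral of
    [F (gam s t) zeta / (zeta - z)] does not depend on [s]: its [s]-derivative is the integral
    of [f (gam s t) zeta], which for [s <> 0] is the [t]-derivative of the periodic function
    [F (gam s t) / (i s)], and for [s = 0] is a multiple of the integral of [zeta]. At [s = 0]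
    there remains [F z] times the winding integral. *)
Theorem cauchy_formula_C1 (F f : C -> C) (r : R) (z : C) : r < 1 -> Cmod z < r ->
  disk_continuous f -> (forall w, unit_disk w -> is_Cderive F w (f w)) ->
  transform r (fun t => F (circle r t) * circle r t)%C 1 z = (2 * PI * F z)%C.
Proof.
  intros Hr Hz Cf HF. pose proof (Cmod_ge_0 z) as Pz. pose proof two_PI_pos as HPI.
  assert (CF : disk_continuous F) by (intros w Hw; exact (is_Cderive_continuous _ _ _ (HF w Hw))).
  set (gam := fun s t : R => (z + s * (circle r t - z))%C).
  assert (Hg : forall s t, 0 <= s <= 1 -> Cmod (gam s t) <= r).
  { intros s t Hs. apply convex_disk; [lra| |exact Hs]. rewrite Cmod_circle; lra. }
  assert (Dg : forall s t, 0 <= s <= 1 -> unit_disk (gam s t)).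
  { intros s t Hs. specialize (Hg s t Hs). unfold unit_disk. lra. }
  assert (N : forall t, (circle r t - z)%C <> 0) by (intros t; now apply circle_minus_neq).
  assert (Cg : forall s t, Rcontinuous (gam s) t).
  { intros s t. apply cont_plus; [apply cont_const|]. apply cont_mult; [apply cont_const|].
    apply cont_minus; [apply continuous_circle|apply cont_const]. }
  assert (Ck : forall t, Rcontinuous (fun t => circle r t * / (circle r t - z))%C t).
  { intros t. apply cont_mult; [apply continuous_circle|]. apply cont_inv; [apply N|].
    apply cont_minus; [apply continuous_circle|apply cont_const]. }
  set (A := fun s t => (F (gam s t) * (circle r t * / (circle r t - z)))%C).
  set (Phi := fun s => CRInt (A s) 0 (2 * PI)).
  assert (IA : forall s, (forall t, Cmod (gam s t) < 1) -> is_CRInt (A s) 0 (2 * PI) (Phi s)).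
  { intros s G. apply CRInt_correct; [lra|]. intros t _.
    apply cont_mult; [|apply Ck]. apply (continuous_comp (gam s) F); [apply Cg|].
    apply CF, G. }
  assert (IB : forall s, 0 <= s <= 1 ->
    is_CRInt (fun t => f (gam s t) * circle r t)%C 0 (2 * PI) 0).
  { intros s Hs.
    assert (I0 : is_CRInt (fun t => 1 * (Ci * circle r t))%C 0 (2 * PI) 0).
    { apply (circle_integral_derive r (fun y => y) (fun _ => RtoC 1)).
      - intros t; apply is_Cderive_id.
      - intros t; apply cont_const. }
    assert (EC : (Ci * Ci)%C = (- (1))%C) by (apply injective_projections; cbn; ring).
    destruct (Req_dec s 0) as [->|Hs0].
    - apply (is_CRInt_mult (- Ci * f z)) in I0. rewrite Cmult_0_r in I0.
      eapply is_CRInt_ext; [lra| |exact I0]. intros t _. cbv beta.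
      replace (gam 0 t) with z by (unfold gam; ring).
      transitivity (- (Ci * Ci) * f z * circle r t)%C; [ring|]. rewrite EC. ring.
    - assert (I1 : is_CRInt (fun t => f (gam s t) * (s * (Ci * circle r t)))%C 0 (2 * PI)
         (F (gam s (2 * PI)%R) - F (gam s 0))).
      { apply (is_CRInt_derive (fun t => F (gam s t))); [lra| |].
        - intros t _. apply is_RCderive_comp; [now apply HF, Dg|].
          apply (is_RCderive_comp (fun w => z + s * (w - z))%C (circle r)); [|apply is_RCderive_circle].
          apply (Caratheodory_all _ (fun _ => RtoC s)); [apply cont_const|]. intros w; ring.
        - intros t _. apply cont_mult.
          + apply (continuous_comp (gam s) f); [apply Cg|now apply Cf, Dg].
          + apply cont_mult; [apply cont_const|].
            apply cont_mult; [apply cont_const|apply continuous_circle]. }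
      unfold gam at 2 3 in I1. rewrite circle_period in I1.
      replace (F (z + s * (circle r 0 - z)) - F (z + s * (circle r 0 - z)))%C with (RtoC 0) in I1 by ring.
      apply (is_CRInt_mult (- Ci / s)) in I1. rewrite Cmult_0_r in I1.
      eapply is_CRInt_ext; [lra| |exact I1]. intros t _. cbv beta.
      assert (RtoC s <> 0) by (intros E; apply RtoC_inj in E; auto).
      transitivity (- (Ci * Ci) * f (gam s t) * circle r t)%C; [field; auto|]. rewrite EC. ring. }
  assert (E : Phi 0 = Phi 1).
  { apply RCderive_zero_const. intros s Hs. apply is_RCderive_Cmod. intros e He.
    assert (He' : 0 < e / (2 * PI)) by (apply Rdiv_lt_0_compat; lra).
    destruct (uniform_differentiability F f r _ Hr He' Cf HF) as (d & Hd & K).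
    assert (Hd' : 0 < Rmin d (1 - r) / 2) by (apply Rdiv_lt_0_compat; [apply Rmin_glb_lt; lra|lra]).
    exists (mkposreal _ Hd'). intros s' B.
    change (Rabs (s' - s) < Rmin d (1 - r) / 2) in B.
    pose proof (Rmin_l d (1 - r)). pose proof (Rmin_r d (1 - r)).
    set (h := fun t => ((s' - s) * (circle r t - z))%C).
    assert (Hh : forall t, Cmod (h t) <= Rabs (s' - s) * Cmod (circle r t - z)).
    { intros t. unfold h. rewrite Cmod_mult, <- RtoC_minus, Cmod_R. lra. }
    assert (Hc : forall t, Cmod (circle r t - z) <= 2).
    { intros t. unfold Cminus. eapply Rle_trans; [apply Cmod_triangle|].
      rewrite Cmod_opp, Cmod_circle; lra. }
    assert (Hh2 : forall t, Cmod (h t) < Rmin d (1 - r)).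
    { intros t. eapply Rle_lt_trans; [apply Hh|]. specialize (Hc t).
      pose proof (Rabs_pos (s' - s)). nra. }
    assert (Gh : forall t, gam s' t = (gam s t + h t)%C) by (intros t; unfold gam, h; ring).
    assert (G1 : forall t, Cmod (gam s' t) < 1).
    { intros t. rewrite Gh. eapply Rle_lt_trans; [apply Cmod_triangle|].
      specialize (Hg s t Hs). specialize (Hh2 t). lra. }
    pose proof (is_CRInt_minus _ _ _ _ _ _ (is_CRInt_minus _ _ _ _ _ _ (IA s' G1)
      (IA s (fun t => Dg s t Hs))) (is_CRInt_mult (s' - s) _ _ _ _ (IB s Hs))) as D.
    replace (Phi s' - Phi s - 0 * (s' - s))%C with (Phi s' - Phi s - (s' - s) * 0)%C by ring.
    apply is_CRInt_bound with (M := e / (2 * PI) * Rabs (s' - s)) in D; [|lra|].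
    - eapply Rle_trans; [exact D|]. right. field. lra.
    - intros t _. unfold A.
      replace (F (gam s' t) * (circle r t * / (circle r t - z))
         - F (gam s t) * (circle r t * / (circle r t - z))
         - (s' - s) * (f (gam s t) * circle r t))%C
       with ((F (gam s t + h t)%C - F (gam s t) - f (gam s t) * h t)
           * (circle r t * / (circle r t - z)))%C.
      2:{ rewrite <- Gh. unfold h. field. apply N. }
      rewrite !Cmod_mult, Cmod_circle, Cmod_inv by (lra || apply N).
      assert (Pn : 0 < Cmod (circle r t - z)) by (apply Cmod_gt_0, N).
      eapply Rle_trans.
      { apply Rmult_le_compat_r.
        - apply Rmult_le_pos; [lra|]. left. now apply Rinv_0_lt_compat.
        - apply K; [now apply Hg|]. specialize (Hh2 t). lra. }
      apply Rle_trans with (e / (2 * PI) * (Rabs (s' - s) * Cmod (circle r t - z)) *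
         (r * / Cmod (circle r t - z))).
      { apply Rmult_le_compat_r.
        - apply Rmult_le_pos; [lra|]. left. now apply Rinv_0_lt_compat.
        - apply Rmult_le_compat_l; [lra|apply Hh]. }
      replace (e / (2 * PI) * (Rabs (s' - s) * Cmod (circle r t - z)) * (r * / Cmod (circle r t - z)))
        with (e / (2 * PI) * Rabs (s' - s) * r) by (field; lra).
      rewrite <- (Rmult_1_r (e / (2 * PI) * Rabs (s' - s))) at 2.
      apply Rmult_le_compat_l; [|lra]. apply Rmult_le_pos; [lra|apply Rabs_pos]. }
  transitivity (Phi 1).
  { apply transform_unique. eapply is_CRInt_ext; [lra| |apply (IA 1)].
    - intros t _. unfold A. replace (gam 1 t) with (circle r t) by (unfold gam; ring).
      cbn [Cpow]. ring.
    - intros t. apply Dg. lra. }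
  rewrite <- E.
  assert (W : circle_weight (circle r)) by (intros t _; apply continuous_circle).
  pose proof (transform_correct r (circle r) 1 z W Hz) as I.
  rewrite winding_integral, RtoC_mult in I by exact Hz.
  apply (is_CRInt_mult (F z)) in I.
  apply (is_CRInt_unique (A 0) 0 (2 * PI)); [apply IA; intros t; apply Dg; lra|].
  rewrite Cmult_comm.
  eapply is_CRInt_ext; [lra| |exact I]. intros t _. unfold A.
  replace (gam 0 t) with z by (unfold gam; ring). cbn [Cpow]. ring.
Qed.

(** * Consequences of Cauchy's formula *)

Lemma C_derive_spec (f : C -> C) (z : C) :
  holomorphic_on unit_disk f -> unit_disk z -> is_Cderive f z (C_derive f z).
Proof.
  intros H Hz. destruct (H z Hz) as [l Hl].
  rewrite (is_C_derive_unique f z l Hl). exact Hl.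
Qed.

Lemma locally_disk (r : R) (z : C) : Cmod z < r ->
  @locally C_UniformSpace z (fun w => Cmod w < r).
Proof.
  intros H. apply locally_Cmod. exists (r - Cmod z). split; [lra|]. intros y Hy.
  pose proof (Cmod_triangle_minus y z). lra.
Qed.

Lemma circle_weight_comp (f : C -> C) (r : R) : 0 <= r < 1 -> disk_continuous f ->
  circle_weight (fun t => f (circle r t) * circle r t)%C.
Proof.
  intros Hr Hf t _. apply cont_mult; [|apply continuous_circle].
  apply (continuous_comp (circle r) f); [apply continuous_circle|].
  apply Hf. unfold unit_disk. rewrite Cmod_circle; lra.
Qed.

Lemma two_PI_neq : RtoC (2 * PI) <> 0.
Proof. intros E. apply RtoC_inj in E. pose proof two_PI_pos. lra. Qed.

(** With [F' = f], Cauchy's formula for [F] represents [f] and [f'] near [z] as transforms with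
    exponents 2 and 3, and every transform is differentiable. *)
Theorem holomorphic_C_derive (f : C -> C) :
  holomorphic_on unit_disk f -> holomorphic_on unit_disk (C_derive f).
Proof.
  intros Hf z Hz. destruct (holomorphic_primitive f Hf) as [F HF].
  pose proof (holomorphic_continuous f Hf) as Cf.
  assert (CF : disk_continuous F) by (intros w Hw; exact (is_Cderive_continuous _ _ _ (HF w Hw))).
  unfold unit_disk in Hz. pose proof (Cmod_ge_0 z).
  set (r := (1 + Cmod z) / 2).
  assert (Hr : Cmod z < r < 1) by (unfold r; lra).
  set (phi := fun t => (F (circle r t) * circle r t)%C).
  assert (W : circle_weight phi) by (apply circle_weight_comp; [lra|exact CF]).
  assert (D1 : forall w, Cmod w < r -> f w = (/ (2 * PI)%R * transform r phi 2 w)%C).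
  { intros w Hw. assert (Dw : unit_disk w) by (unfold unit_disk; lra).
    pose proof (is_Cderive_mult (fun _ => / (2 * PI)%R)%C (transform r phi 1) w _ _
       (is_Cderive_const _ _) (transform_derive r phi 1 w W Hw)) as D.
    apply (is_Cderive_unique F w).
    - now apply HF.
    - replace (/ (2 * PI)%R * transform r phi 2 w)%C with
       (0 * transform r phi 1 w + / (2 * PI)%R * (INR 1 * transform r phi 2 w))%C
       by (cbn [INR]; ring).
      eapply is_Cderive_ext_loc; [|exact D].
      generalize (locally_disk r w Hw). apply filter_imp. intros y Hy.
      unfold phi. rewrite (cauchy_formula_C1 F f r y); auto; try lra.
      rewrite RtoC_mult. pose proof two_PI_neq as N. rewrite RtoC_mult in N. field.
      intros E. apply N. rewrite E. ring. }
  assert (D2 : forall w, Cmod w < r ->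
    C_derive f w = (/ (2 * PI)%R * (INR 2 * transform r phi 3 w))%C).
  { intros w Hw. assert (Dw : unit_disk w) by (unfold unit_disk; lra).
    pose proof (is_Cderive_mult (fun _ => / (2 * PI)%R)%C (transform r phi 2) w _ _
       (is_Cderive_const _ _) (transform_derive r phi 2 w W Hw)) as D.
    apply is_C_derive_unique.
    replace (/ (2 * PI)%R * (INR 2 * transform r phi 3 w))%C with
       (0 * transform r phi 2 w + / (2 * PI)%R * (INR 2 * transform r phi 3 w))%C by ring.
    eapply is_Cderive_ext_loc; [|exact D].
    generalize (locally_disk r w Hw). apply filter_imp. intros y Hy. symmetry. now apply D1. }
  pose proof (is_Cderive_mult (fun _ => / (2 * PI)%R * INR 2)%C (transform r phi 3) z _ _
       (is_Cderive_const _ _) (transform_derive r phi 3 z W (proj1 Hr))) as D.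
  eexists. eapply is_Cderive_ext_loc; [|exact D].
  generalize (locally_disk r z (proj1 Hr)). apply filter_imp. intros y Hy.
  rewrite D2 by exact Hy. ring.
Qed.

Theorem cauchy_formula (f : C -> C) (r : R) (z : C) : r < 1 -> Cmod z < r ->
  holomorphic_on unit_disk f ->
  transform r (fun t => f (circle r t) * circle r t)%C 1 z = (2 * PI * f z)%C.
Proof.
  intros Hr Hz Hf. apply (cauchy_formula_C1 f (C_derive f)); auto.
  - now apply holomorphic_continuous, holomorphic_C_derive.
  - intros w Hw. now apply C_derive_spec.
Qed.

(** The quotient is a transform of [f] restricted to the circle, hence differentiable also at
    the origin. *)
Theorem removable_quotient (f : C -> C) : holomorphic_on unit_disk f -> f 0 = 0 ->
  exists g, holomorphic_on unit_disk g /\ forall z, unit_disk z -> f z = (z * g z)%C.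
Proof.
  intros Hf H0.
  set (g := fun z => if Ceq_dec z 0 then C_derive f 0 else (f z / z)%C).
  exists g. split.
  2:{ intros z Hz. unfold g. destruct (Ceq_dec z 0) as [->|n]; [rewrite H0; ring|field; exact n]. }
  intros z Hz. unfold unit_disk in Hz. pose proof (Cmod_ge_0 z).
  set (r := (1 + Cmod z) / 2).
  assert (Hr : Cmod z < r < 1) by (unfold r; lra).
  set (psi := fun t => f (circle r t)).
  assert (W : circle_weight psi).
  { intros t _. apply (continuous_comp (circle r) f); [apply continuous_circle|].
    apply (holomorphic_continuous f Hf). unfold unit_disk. rewrite Cmod_circle; lra. }
  set (k := fun w => (/ (2 * PI)%R * transform r psi 1 w)%C).
  assert (Dk : forall w, Cmod w < r -> exists l, is_Cderive k w l).
  { intros w Hw. eexists. apply is_Cderive_mult; [apply is_Cderive_const|].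
    now apply transform_derive. }
  assert (H0r : Cmod 0 < r) by (rewrite Cmod_0; lra).
  (* Subtract Cauchy's formulas at [w] and at [0]:
     [zeta / (zeta - w) - zeta / zeta = w / (zeta - w)]. *)
  assert (Ek : forall w, Cmod w < r -> f w = (w * k w)%C).
  { intros w Hw.
    pose proof two_PI_pos as P. pose proof two_PI_neq as N.
    assert (Hfw : forall y, Cmod y < r -> is_CRInt (fun t => f (circle r t) * circle r t *
        (/ (circle r t - y)) ^ 1)%C 0 (2 * PI) ((2 * PI)%R * f y)).
    { intros y Hy. rewrite RtoC_mult, <- (cauchy_formula f r y) by (lra || assumption).
      apply transform_correct; [|exact Hy]. apply circle_weight_comp; [lra|].
      now apply holomorphic_continuous. }
    pose proof (is_CRInt_minus _ _ _ _ _ _ (Hfw w Hw) (Hfw 0 H0r)) as D.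
    rewrite H0 in D.
    pose proof (is_CRInt_mult w _ _ _ _ (transform_correct r psi 1 w W Hw)) as D'.
    assert (E : ((2 * PI)%R * f w - (2 * PI)%R * 0)%C = (w * transform r psi 1 w)%C).
    { eapply is_CRInt_unique; [exact D|]. eapply is_CRInt_ext; [lra| |exact D'].
      intros t _. unfold psi. cbn [Cpow]. pose proof (circle_minus_neq r t w Hw).
      assert (N0 : circle r t <> 0).
      { replace (circle r t) with (circle r t - 0)%C by ring. now apply circle_minus_neq. }
      field. auto. }
    replace (f w) with (/ (2 * PI)%R * ((2 * PI)%R * f w - (2 * PI)%R * 0))%C by (field; exact N).
    rewrite E. unfold k. ring. }
  assert (Eg : forall w, Cmod w < r -> k w = g w).
  { intros w Hw. unfold g. destruct (Ceq_dec w 0) as [->|n].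
    - symmetry. apply is_C_derive_unique. destruct (Dk 0 H0r) as [l Hl].
      apply (Caratheodory_loc f k 0); [exact (is_Cderive_continuous _ _ _ Hl)|].
      generalize (locally_disk r 0 H0r). apply filter_imp. intros y Hy.
      rewrite (Ek y Hy), H0. ring.
    - rewrite (Ek w Hw). field. exact n. }
  destruct (Dk z (proj1 Hr)) as [l Hl]. exists l. eapply is_Cderive_ext_loc; [|exact Hl].
  generalize (locally_disk r z (proj1 Hr)). apply filter_imp. exact Eg.
Qed.

Lemma holomorphic_mult (f g : C -> C) :
  holomorphic_on unit_disk f -> holomorphic_on unit_disk g ->
  holomorphic_on unit_disk (fun z => f z * g z)%C.
Proof.
  intros Hf Hg z Hz. destruct (Hf z Hz) as [a Ha]. destruct (Hg z Hz) as [b Hb].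
  eexists. apply is_Cderive_mult; eassumption.
Qed.

Lemma holomorphic_pow (f : C -> C) (n : nat) :
  holomorphic_on unit_disk f -> holomorphic_on unit_disk (fun z => (f z) ^ n)%C.
Proof.
  intros Hf. induction n as [|n IH].
  - intros z _. exists (RtoC 0). exact (is_Cderive_const 1 z).
  - now apply (holomorphic_mult f (fun z => (f z) ^ n)%C).
Qed.

(** Cauchy's formula for [f] loses a constant factor, which disappears on applying it to
    the powers of [f] and taking roots. *)
Theorem maximum_modulus (f : C -> C) (r M : R) (z : C) : r < 1 -> Cmod z < r -> 0 < M ->
  holomorphic_on unit_disk f -> (forall w, Cmod w = r -> Cmod (f w) <= M) -> Cmod (f z) <= M.
Proof.
  intros Hr Hz HM Hf B. pose proof two_PI_pos as P. pose proof (Cmod_ge_0 z) as Pz.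
  apply Rnot_lt_le. intros L.
  set (K := r / (r - Cmod z)).
  assert (HK : forall n, Cmod (f z) ^ n <= K * M ^ n).
  { intros n. pose proof (holomorphic_pow f n Hf) as Hn.
    assert (T : is_CRInt (fun t => (f (circle r t)) ^ n * circle r t *
        (/ (circle r t - z)) ^ 1)%C 0 (2 * PI) ((2 * PI)%R * (f z) ^ n)).
    { rewrite RtoC_mult, <- (cauchy_formula (fun z => (f z) ^ n)%C r z) by (lra || assumption).
      apply transform_correct; [|exact Hz].
      apply (circle_weight_comp (fun z => (f z) ^ n)%C); [lra|].
      now apply holomorphic_continuous. }
    apply is_CRInt_bound with (M := K * M ^ n) in T; [|lra|].
    - rewrite Cmod_mult, Cmod_R, Cmod_pow, Rabs_pos_eq in T by lra. nra.
    - intros t _. cbn [Cpow]. pose proof (circle_minus_neq r t z Hz).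
      rewrite !Cmod_mult, Cmod_1, Rmult_1_r, Cmod_inv, Cmod_pow, Cmod_circle by (auto || lra).
      pose proof (circle_minus_lower r t z ltac:(lra)) as Lo.
      replace (K * M ^ n) with (M ^ n * r * / (r - Cmod z)) by (unfold K; field; lra).
      apply Rmult_le_compat.
      + apply Rmult_le_pos; [apply pow_le, Cmod_ge_0|lra].
      + left. apply Rinv_0_lt_compat. lra.
      + apply Rmult_le_compat_r; [lra|]. apply pow_incr. split; [apply Cmod_ge_0|].
        apply B, Cmod_circle. lra.
      + apply Rinv_le_contravar; lra. }
  assert (Q : Rabs (Cmod (f z) / M) > 1).
  { rewrite Rabs_pos_eq.
    - apply Rmult_lt_reg_r with M; [exact HM|]. unfold Rdiv. rewrite Rmult_assoc, Rinv_l; lra.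
    - apply Rdiv_le_0_compat; [apply Cmod_ge_0|exact HM]. }
  destruct (Pow_x_infinity _ Q (K + 1)) as [n Hn].
  specialize (Hn n (le_n n)). specialize (HK n).
  assert (Pn : 0 < M ^ n) by now apply pow_lt.
  rewrite Rabs_pos_eq in Hn.
  2:{ apply pow_le, Rdiv_le_0_compat; [apply Cmod_ge_0|exact HM]. }
  unfold Rdiv in Hn. rewrite Rpow_mult_distr, pow_inv in Hn.
  assert (E : Cmod (f z) ^ n = Cmod (f z) ^ n * / M ^ n * M ^ n) by (field; lra).
  nra.
Qed.

(** * Jack's lemma *)

(** Among the points with [|w| >= 1] there is one of least modulus: if the infimum of the moduli
    were not attained, compactness of the disk of that radius would push it outwards. *)
Lemma first_contact (w : C -> C) (zs : C) : disk_continuous w ->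
  unit_disk zs -> 1 <= Cmod (w zs) ->
  exists z0, unit_disk z0 /\ 1 <= Cmod (w z0) /\ forall y, Cmod y < Cmod z0 -> Cmod (w y) < 1.
Proof.
  intros Cw Hs Bs. unfold unit_disk in *.
  destruct (completeness (fun x => exists z, Cmod z < 1 /\ 1 <= Cmod (w z) /\ x = - Cmod z))
    as [m [U L]].
  { exists 0. intros x (z & _ & _ & ->). pose proof (Cmod_ge_0 z). lra. }
  { exists (- Cmod zs), zs. auto. }
  assert (Hr : forall z, Cmod z < 1 -> 1 <= Cmod (w z) -> - m <= Cmod z).
  { intros z H1 H2. assert (- Cmod z <= m) by (apply U; exists z; auto). lra. }
  assert (m <= 0) by (apply L; intros x (z & _ & _ & ->); pose proof (Cmod_ge_0 z); lra).
  pose proof (Hr zs Hs Bs) as Hm.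
  assert (X : exists z0, Cmod z0 <= - m /\ 1 <= Cmod (w z0)).
  { apply NNPP. intros N.
    destruct (disk_compactness (- m) (fun c d => forall y, Cmod (y - c) < 2 * d ->
       Cmod (w y) < 1)) as (d & Hd & K).
    { intros c Hc. assert (Bc : 0 < 1 - Cmod (w c)).
      { apply Rnot_le_lt. intros B. apply N. exists c. lra. }
      pose proof (proj1 (continuous_Cmod _ _ _) (Cw c ltac:(unfold unit_disk; lra)) _ Bc) as Lc.
      apply locally_Cmod in Lc. destruct Lc as (d & Hd & Lc).
      exists (d / 2). split; [lra|]. intros y Hy.
      pose proof (Lc y ltac:(lra)) as Y. pose proof (Cmod_triangle_minus (w y) (w c)). lra. }
    assert (m <= m - d); [|lra].
    apply L. intros x (z & H1 & H2 & ->). specialize (Hr z H1 H2).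
    apply Ropp_le_cancel. rewrite Ropp_involutive. apply Rnot_lt_le. intros B.
    assert (P : exists p, Cmod p <= - m /\ Cmod (z - p) < d).
    { destruct (Req_dec (Cmod z) 0) as [Z|Z].
      - exists z. split; [lra|]. replace (z - z)%C with (RtoC 0) by ring. rewrite Cmod_0. lra.
      - pose proof (Cmod_ge_0 z). exists ((- m / Cmod z)%R * z)%C. split.
        + rewrite Cmod_mult, Cmod_R, Rabs_pos_eq by (apply Rdiv_le_0_compat; lra).
          right. field. exact Z.
        + replace (z - (- m / Cmod z)%R * z)%C with ((1 - - m / Cmod z)%R * z)%C
            by (rewrite RtoC_minus; ring).
          rewrite Cmod_mult, Cmod_R, Rabs_pos_eq.
          * replace ((1 - - m / Cmod z) * Cmod z) with (Cmod z + m) by (field; exact Z). lra.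
          * assert (- m / Cmod z <= 1); [|lra]. apply Rmult_le_reg_r with (Cmod z); [lra|].
            unfold Rdiv. rewrite Rmult_assoc, Rinv_l; lra. }
    destruct P as (p & Hp & Hzp). destruct (K p Hp) as (c & d' & Q & Hd' & Hc).
    assert (Cmod (w z) < 1); [|lra]. apply Q.
    replace (z - c)%C with (z - p + (p - c))%C by ring.
    eapply Rle_lt_trans; [apply Cmod_triangle|]. lra. }
  destruct X as (z0 & H0 & B0). exists z0. split; [lra|]. split; [exact B0|].
  intros y Hy. apply Rnot_le_lt. intros B. specialize (Hr y ltac:(lra) B). lra.
Qed.

Lemma radial_limit_le (f : C -> C) (z : C) : Ccontinuous f z -> z <> 0 ->
  (forall y, Cmod y < Cmod z -> Cmod (f y) < 1) -> Cmod (f z) <= 1.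
Proof.
  intros Cf Nz H. apply Rnot_lt_le. intros B. apply Cmod_gt_0 in Nz.
  assert (He : 0 < Cmod (f z) - 1) by lra.
  pose proof (proj1 (continuous_Cmod _ _ _) Cf _ He) as L.
  apply locally_Cmod in L. destruct L as (d & Hd & L).
  set (s := Rmin (1 / 2) (d / (2 * Cmod z))).
  assert (Hs : 0 < s) by (apply Rmin_glb_lt; [lra|apply Rdiv_lt_0_compat; lra]).
  pose proof (Rmin_l (1 / 2) (d / (2 * Cmod z))) as s1. fold s in s1.
  pose proof (Rmin_r (1 / 2) (d / (2 * Cmod z))) as s2. fold s in s2.
  assert (E : d / (2 * Cmod z) * (2 * Cmod z) = d) by (field; lra).
  specialize (H ((1 - s)%R * z)%C). specialize (L ((1 - s)%R * z)%C).
  rewrite Cmod_mult, Cmod_R, Rabs_pos_eq in H by lra.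
  replace ((1 - s)%R * z - z)%C with ((- s)%R * z)%C in L
    by (rewrite RtoC_minus, RtoC_opp; ring).
  rewrite Cmod_mult, Cmod_R, Rabs_Ropp, Rabs_pos_eq in L by lra.
  specialize (H ltac:(nra)). specialize (L ltac:(nra)).
  rewrite Cmod_minus_sym in L. pose proof (Cmod_triangle_minus (f z) (f ((1 - s)%R * z)%C)). lra.
Qed.

Lemma Cmod_one_plus (h : C) : Cmod (1 + h) <= 1 + Re h + (Cmod h) ^ 2 / 2.
Proof.
  pose proof (Cmod2_alt (1 + h)) as E. pose proof (Cmod2_alt h) as Eh.
  rewrite re_plus, im_plus, re_RtoC, im_RtoC in E.
  pose proof (pow2_ge_0 (Cmod (1 + h) - 1)). nra.
Qed.

(** The infinitesimal form of Schwarz's lemma at a boundary point. Put [y = z0 (1 + a eta)] with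
    [a > 0] small: [|y| / |z0|] is [1 + a Re eta] to first order, while [|w y|] is at least
    [Re (conj (w z0) w y)], which is [1 + a Re (conj (w z0) l z0 eta)] to first order. *)
Lemma contact_direction (w : C -> C) (z0 l : C) (eta : C) : is_Cderive w z0 l -> z0 <> 0 ->
  Cmod (w z0) = 1 ->
  (forall y, Cmod y < Cmod z0 -> Cmod (w y) <= Cmod y / Cmod z0) ->
  Re eta < 0 -> Re (Cconj (w z0) * (l * z0) * eta) <= Re eta.
Proof.
  intros Dw Nz W1 B He. apply Cmod_gt_0 in Nz as Pz.
  apply le_epsilon. intros e Pe.
  set (N := Cmod eta). assert (PN : 0 <= N) by apply Cmod_ge_0.
  set (r := Cmod z0) in *.
  set (e' := e / (2 * (r * N + 1))).
  assert (PrN : 0 <= r * N) by (apply Rmult_le_pos; lra).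
  assert (Pe' : 0 < e') by (apply Rdiv_lt_0_compat; lra).
  pose proof (proj1 (is_Cderive_Cmod _ _ _) Dw _ Pe') as L.
  apply locally_Cmod in L. destruct L as (d & Pd & L).
  (* The step [a] keeps [y] where the derivative approximates within [e'], makes the second-order
     term [a N^2 / 2] less than [e / 2], and keeps [y] in the disk of radius [|z0|]. *)
  set (a := Rmin (d / (2 * (r * N + 1))) (Rmin (e / (N ^ 2 + 1)) (- Re eta / (N ^ 2 + 1)))).
  assert (PN2 : 0 < N ^ 2 + 1) by nra.
  assert (Pa : 0 < a).
  { repeat apply Rmin_glb_lt; apply Rdiv_lt_0_compat; lra. }
  assert (a1 : a <= d / (2 * (r * N + 1))) by apply Rmin_l.
  assert (a2 : a <= e / (N ^ 2 + 1)).
  { eapply Rle_trans; [apply Rmin_r|apply Rmin_l]. }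
  assert (a3 : a <= - Re eta / (N ^ 2 + 1)).
  { eapply Rle_trans; [apply Rmin_r|apply Rmin_r]. }
  assert (a2' : a * (N ^ 2 + 1) <= e).
  { replace e with (e / (N ^ 2 + 1) * (N ^ 2 + 1)) by (field; lra).
    apply Rmult_le_compat_r; lra. }
  assert (a3' : a * (N ^ 2 + 1) <= - Re eta).
  { replace (- Re eta) with (- Re eta / (N ^ 2 + 1) * (N ^ 2 + 1)) by (field; lra).
    apply Rmult_le_compat_r; lra. }
  assert (a1' : a * (r * N) < d).
  { apply Rle_lt_trans with (a * (r * N + 1)); [nra|].
    apply Rle_lt_trans with (d / (2 * (r * N + 1)) * (r * N + 1)).
    - apply Rmult_le_compat_r; lra.
    - replace (d / (2 * (r * N + 1)) * (r * N + 1)) with (d / 2) by (field; lra). lra. }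
  assert (e'1 : e' * (r * N) <= e / 2).
  { replace (e / 2) with (e' * (r * N + 1)) by (unfold e'; field; lra).
    apply Rmult_le_compat_l; lra. }
  set (y := (z0 * (1 + a * eta))%C).
  assert (Ey : (y - z0)%C = (a * (z0 * eta))%C) by (unfold y; ring).
  assert (My : Cmod (y - z0) = a * (r * N)).
  { rewrite Ey, !Cmod_mult, Cmod_R, Rabs_pos_eq by lra. reflexivity. }
  specialize (L y ltac:(rewrite My; exact a1')).
  rewrite My, Ey in L.
  assert (Q : Cmod (1 + a * eta) <= 1 + a * Re eta + a * (a * N ^ 2) / 2).
  { eapply Rle_trans; [apply Cmod_one_plus|]. rewrite re_scal_l, Cmod_mult, Cmod_R, Rabs_pos_eq by lra.
    fold N. right. field. }
  assert (Q1 : Cmod (1 + a * eta) < 1) by nra.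
  assert (By : Cmod (w y) <= Cmod (1 + a * eta)).
  { eapply Rle_trans; [apply B; unfold y; rewrite Cmod_mult; fold r; nra|].
    unfold y. rewrite Cmod_mult. fold r. right. field. lra. }
  set (u := Cconj (w z0)).
  assert (Mu : Cmod u = 1) by (unfold u; rewrite Cmod_conj; exact W1).
  assert (Eu : (u * w z0)%C = 1).
  { unfold u. rewrite Cmult_comm, <- Cmod2_conj, W1. f_equal. ring. }
  set (R0 := (w y - w z0 - l * (a * (z0 * eta)))%C) in *.
  assert (T : Re (u * w y) = 1 + a * Re (u * (l * z0) * eta) + Re (u * R0)).
  { replace (u * w y)%C with (u * w z0 + a * (u * (l * z0) * eta) + u * R0)%C by (unfold R0; ring).
    rewrite Eu, !re_plus, re_RtoC, re_scal_l. reflexivity. }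
  pose proof (re_le_Cmod (u * w y)) as T1. apply Rabs_le_between in T1.
  pose proof (re_le_Cmod (u * R0)) as T2. apply Rabs_le_between in T2.
  rewrite Cmod_mult, Mu, Rmult_1_l in T1, T2.
  apply Rmult_le_reg_l with a; [exact Pa|]. nra.
Qed.

(** Let [kap] be the logarithmic derivative [z0 w'(z0) / w(z0)] at the first point of contact.
    Schwarz's lemma yields [Re (kap eta) <= Re eta] whenever [Re eta < 0]; [eta = -1] gives
    [Re kap >= 1], and letting [Im eta] vary freely forces [Im kap = 0]. *)
Theorem jack (w : C -> C) (zs : C) : holomorphic_on unit_disk w -> w 0 = 0 ->
  unit_disk zs -> 1 <= Cmod (w zs) ->
  exists z0 k, unit_disk z0 /\ 1 <= k /\ Cmod (w z0) = 1 /\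
    (z0 * C_derive w z0)%C = (k * w z0)%C.
Proof.
  intros Hw W0 Ds Bs. pose proof (holomorphic_continuous w Hw) as Cw.
  destruct (first_contact w zs Cw Ds Bs) as (z0 & D0 & B0 & In).
  assert (Nz : z0 <> 0).
  { intros ->. rewrite W0, Cmod_0 in B0. lra. }
  apply Cmod_gt_0 in Nz as Pz. set (r := Cmod z0) in *.
  assert (Bd : forall y, Cmod y = r -> Cmod (w y) <= 1).
  { intros y Hy. apply radial_limit_le.
    - apply Cw. unfold unit_disk in *. fold r in D0. lra.
    - apply Cmod_gt_0. lra.
    - rewrite Hy. exact In. }
  assert (W1 : Cmod (w z0) = 1) by (apply Rle_antisym; [now apply Bd|exact B0]).
  (* Schwarz's lemma: [g = w / y] is bounded by [1 / r] on the circle, hence inside. *)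
  destruct (removable_quotient w Hw W0) as (g & Hg & Eg).
  unfold unit_disk in D0. fold r in D0.
  assert (Sch : forall y, Cmod y < r -> Cmod (w y) <= Cmod y / r).
  { intros y Hy. rewrite Eg by (unfold unit_disk; lra). rewrite Cmod_mult.
    apply Rmult_le_compat_l; [apply Cmod_ge_0|].
    apply (maximum_modulus g r); auto; [now apply Rinv_0_lt_compat|].
    intros v Hv. specialize (Bd v Hv). rewrite Eg, Cmod_mult, Hv in Bd by (unfold unit_disk; lra).
    apply Rmult_le_reg_l with r; [exact Pz|]. rewrite Rinv_r; lra. }
  pose proof (C_derive_spec w z0 Hw D0) as Dw. set (l := C_derive w z0) in *.
  set (kap := (Cconj (w z0) * (l * z0))%C).
  assert (Dir : forall eta, Re eta < 0 -> Re (kap * eta) <= Re eta).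
  { intros eta. now apply contact_direction. }
  assert (Kr : 1 <= Re kap).
  { specialize (Dir (- (1))%C). rewrite re_mult, re_opp, im_opp, re_RtoC, im_RtoC in Dir.
    specialize (Dir ltac:(lra)). lra. }
  assert (Ki : Im kap = 0).
  { destruct (Req_dec (Im kap) 0) as [E|E]; [exact E|exfalso].
    (* this [eta] makes [Re (kap eta) = 0 > Re eta] *)
    specialize (Dir (-1, - Re kap / Im kap)). rewrite re_mult in Dir. cbn [Re Im fst snd] in Dir.
    specialize (Dir ltac:(lra)).
    replace (Re kap * -1 - Im kap * (- Re kap / Im kap)) with 0 in Dir by (field; exact E). lra. }
  exists z0, (Re kap). split; [exact D0|]. split; [exact Kr|]. split; [exact W1|].
  assert (Ek : kap = RtoC (Re kap)).
  { apply injective_projections; [reflexivity|exact Ki]. }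
  rewrite <- Ek. unfold kap.
  transitivity (z0 * l * (w z0 * Cconj (w z0)))%C; [|ring].
  rewrite <- Cmod2_conj, W1, pow1. unfold l. ring.
Qed.

(** * The reciprocal of the logarithmic derivative *)

Lemma Re_mobius_unit_circle (w : C) (a : R) : Cmod w = 1 -> w <> 1 ->
  Re ((1 + a * w) / (1 - w)) = (1 - a) / 2.
Proof.
  intros H N.
  pose proof (Cmod2_alt w) as E. rewrite H, pow1 in E.
  destruct w as [x y]. cbn [Re Im fst snd] in E.
  assert (Hx : x <> 1).
  { intros ->. apply N. assert (y = 0) by nra. subst. reflexivity. }
  cbn. assert (D : (1 + - x) * ((1 + - x) * 1) + (0 + - y) * ((0 + - y) * 1) = 2 * (1 - x)).
  { transitivity (1 - 2 * x + (x ^ 2 + y ^ 2)); [ring|rewrite <- E; ring]. }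
  rewrite D. field_simplify_eq; [|lra]. replace (y ^ 2) with (1 - x ^ 2) by lra. ring.
Qed.

Lemma Re_inv_gt_half (h : C) : Cmod (1 - h) < 1 -> Re (/ h) > / 2.
Proof.
  intros H. pose proof (Cmod_ge_0 (1 - h)) as P. pose proof (Cmod2_alt (1 - h)) as E.
  rewrite Re_minus, Im_minus, re_RtoC, im_RtoC in E.
  destruct h as [x y]. cbn [Re Im fst snd] in E.
  assert (L : x * x + y * y < 2 * x) by nra.
  assert (0 < x) by nra.
  cbn. apply Rmult_lt_reg_r with (x * (x * 1) + y * (y * 1)); [nra|].
  field_simplify; nra.
Qed.

(** [h = f / (z f')] extended by [1] at the origin. The last relation is the derivative of
    [f = z f' h] divided by [f'], and stays meaningful where [h] vanishes. *)
Lemma inverse_quotient (f : C -> C) : classA f ->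
  (forall z, unit_disk z -> C_derive f z <> 0) ->
  exists h, holomorphic_on unit_disk h /\ h 0 = 1 /\
    (forall z, unit_disk z -> f z = (z * C_derive f z * h z)%C) /\
    (forall z, unit_disk z -> z <> 0 ->
       (z * C_derive h z)%C = (1 - h z * convex_quot f z)%C).
Proof.
  intros (Hol & F0 & F1) Hd.
  pose proof (holomorphic_C_derive f Hol) as Hol'.
  destruct (removable_quotient f Hol F0) as (g & Hg & Eg).
  assert (Hi : holomorphic_on unit_disk (fun z => / C_derive f z)%C).
  { intros z Hz. eexists. apply is_Cderive_inv; [now apply Hd|now apply C_derive_spec]. }
  set (h := fun z => (g z * / C_derive f z)%C).
  pose proof (holomorphic_mult _ _ Hg Hi) as Hh. change (holomorphic_on unit_disk h) in Hh.
  assert (Eh : forall z, unit_disk z -> f z = (z * C_derive f z * h z)%C).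
  { intros z Hz. rewrite Eg by exact Hz. unfold h. field. now apply Hd. }
  assert (P : forall z, unit_disk z -> C_derive f z =
     ((1 * C_derive f z + z * C_derive (C_derive f) z) * h z
       + z * C_derive f z * C_derive h z)%C).
  { intros z Hz. apply is_C_derive_unique.
    eapply is_Cderive_ext_loc.
    2:{ apply (is_Cderive_mult (fun y => y * C_derive f y)%C h); [|now apply C_derive_spec].
        apply is_Cderive_mult; [apply is_Cderive_id|now apply C_derive_spec]. }
    generalize (locally_disk 1 z Hz). apply filter_imp. intros y Hy. symmetry. now apply Eh. }
  exists h. split; [exact Hh|]. split; [|split; [exact Eh|]].
  - assert (D0 : unit_disk 0) by (unfold unit_disk; rewrite Cmod_0; lra).
    pose proof (P 0 D0) as E. rewrite F1 in E.
    transitivity ((1 * 1 + 0 * C_derive (C_derive f) 0) * h 0 + 0 * 1 * C_derive h 0)%C; [ring|].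
    now rewrite <- E.
  - intros z Hz Nz. specialize (P z Hz). specialize (Hd z Hz). unfold convex_quot.
    specialize (Eh z Hz).
    transitivity ((z * C_derive f z * C_derive h z) / C_derive f z)%C; [field; exact Hd|].
    replace (z * C_derive f z * C_derive h z)%C with
      (C_derive f z - (1 * C_derive f z + z * C_derive (C_derive f) z) * h z)%C.
    + field. exact Hd.
    + rewrite P at 1. ring.
Qed.
(** * The inclusion *)

Theorem theorem3p1 (beta beta1 : R) (hlt : beta < beta1) (hle : beta1 <= 1) :
  forall f : C -> C, M0 beta f -> M0 beta1 f.
Proof.
  intros f (HA & (_ & Hd) & HRe).
  assert (Hd' : forall z, unit_disk z -> C_derive f z <> 0) by (apply Hd; lra).
  destruct (inverse_quotient f HA Hd') as (h & Hh & h0 & Eh & Dh).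
  assert (St : forall z, unit_disk z -> z <> 0 -> h z <> 0 -> starlike_quot f z = (/ h z)%C).
  { intros z Hz Nz Nh. unfold starlike_quot. destruct (Ceq_dec z 0) as [E|_]; [easy|].
    rewrite (Eh z Hz). specialize (Hd' z Hz). field. auto. }
  assert (Bound : forall z, unit_disk z -> Cmod (1 - h z) < 1).
  { intros z Hz. apply Rnot_le_lt. intros B.
    set (w := fun y => (1 - h y)%C).
    assert (Dw : forall y, unit_disk y -> is_Cderive w y (0 - C_derive h y)).
    { intros y Hy. apply is_Cderive_minus; [apply is_Cderive_const|now apply C_derive_spec]. }
    destruct (jack w z) as (z0 & k & D0 & Hk & W1 & J).
    - intros y Hy. eexists. now apply Dw.
    - unfold w. rewrite h0. ring.
    - exact Hz.
    - exact B.
    - rewrite (is_C_derive_unique _ _ _ (Dw z0 D0)) in J.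
      assert (N0 : z0 <> 0).
      { intros ->. unfold w in W1. rewrite h0 in W1.
        replace (1 - 1)%C with (RtoC 0) in W1 by ring. rewrite Cmod_0 in W1. lra. }
      assert (EC : (h z0 * convex_quot f z0)%C = (1 + k * w z0)%C).
      { rewrite <- J. transitivity (1 - z0 * C_derive h z0)%C; [rewrite Dh by assumption|]; ring. }
      destruct (Ceq_dec (h z0) 0) as [E|N].
      + (* [w z0 = 1] leaves [0 = 1 + k]. *)
        unfold w in EC. rewrite E in EC.
        apply (f_equal Re) in EC. rewrite re_plus, !re_scal_l, Re_minus, !re_RtoC in EC. lra.
      + specialize (HRe z0 D0). unfold M0_expr in HRe. rewrite St in HRe by assumption.
        replace (RtoC beta * / h z0 + RtoC (1 - beta) * convex_quot f z0)%C with
          ((beta + (1 - beta)%R * (h z0 * convex_quot f z0)) / (1 - w z0))%C in HRe.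
        2:{ unfold w. field. replace (1 - (1 - h z0))%C with (h z0) by ring. auto. }
        rewrite EC in HRe.
        replace (beta + (1 - beta)%R * (1 + k * w z0))%C
          with (1 + ((1 - beta) * k)%R * w z0)%C in HRe
          by (rewrite RtoC_mult, RtoC_minus; ring).
        rewrite Re_mobius_unit_circle in HRe.
        * nra.
        * exact W1.
        * intros E. apply N. unfold w in E.
          transitivity (1 - (1 - h z0))%C; [ring|rewrite E; ring]. }
  assert (Nh : forall z, unit_disk z -> h z <> 0).
  { intros z Hz E. specialize (Bound z Hz). rewrite E in Bound.
    replace (1 - 0)%C with (RtoC 1) in Bound by ring. rewrite Cmod_1 in Bound. lra. }
  split; [exact HA|]. split; [split|].
  - intros _ z Hz Nz. rewrite (Eh z Hz).
    apply Cmult_neq_0; [apply Cmult_neq_0|]; auto.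
  - intros _. exact Hd'.
  - intros z Hz. destruct (Ceq_dec z 0) as [->|Nz].
    + unfold M0_expr, starlike_quot, convex_quot. destruct (Ceq_dec 0 0) as [_|n]; [|easy].
      replace (beta1 * 1 + RtoC (1 - beta1) * (1 + 0 * C_derive (C_derive f) 0 / C_derive f 0))%C
        with (RtoC 1) by (rewrite RtoC_minus; unfold Cdiv; ring).
      rewrite re_RtoC. lra.
    + specialize (HRe z Hz). pose proof (Re_inv_gt_half _ (Bound z Hz)) as P.
      unfold M0_expr in *. rewrite St in * by auto.
      rewrite re_plus, !re_scal_l in *.
      assert ((1 - beta) * (beta1 * Re (/ h z) + (1 - beta1) * Re (convex_quot f z) - beta1 / 2)
       = (1 - beta1) * (beta * Re (/ h z) + (1 - beta) * Re (convex_quot f z) - beta / 2)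
        + (beta1 - beta) * (Re (/ h z) - / 2)) by field.
      nra.
Qed.
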